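(* Let $E$ and $F$ be Banach lattices, each taken with its lattice multi-norm. (i) Suppose that $F$ is monotonically bounded. Then $\mathcal B_b(E,F)=\mathcal M(E,F)$, and $\|\cdot\|_{mb}$ and $\|\cdot\|_b$ are equivalent on $\mathcal B_b(E,F)$. (ii) Suppose that $F$ has the weak Nakano property. Then $\|\cdot\|_{mb}$ and $\|\cdot\|_b$ are equivalent on $\mathcal B_b(E,F)$, with equality of norms when $F$ has the Nakano property. (iii) Suppose that $F$ is monotonically bounded and has the Nakano property. Then $\mathcal B_b(E,F)=\mathcal M(E,F)$ and $\|T\|_{mb}=\|T\|_b$ for $T\in\mathcal B_b(E,F)$. (iv) Suppose that $F$ is monotonically bounded and Dedekind complete. Then $\mathcal B_r(E,F)=\mathcal B_b(E,F)=\mathcal M(E,F)$, and $\|\cdot\|_{mb}$ and $\|\cdot\|_r$ are equivalent on $\mathcal B_r(E,F)$, with equality of norms when $F$ has the Nakano property.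
   Context: A Banach lattice is here the complexification $E=E_{\mathbb R}\oplus iE_{\mathbb R}$ of a real Banach lattice $E_{\mathbb R}$, with modulus $|x+iy|=\bigvee\{x\cos\theta+y\sin\theta:0\le\theta\le2\pi\}$ and norm $\|z\|=\|\,|z|\,\|$; $E^+$ is the positive cone of $E_{\mathbb R}$. $E$ is Dedekind complete if every non-empty subset of $E_{\mathbb R}$ that is bounded above has a supremum. $E$ is monotonically bounded if every increasing net in $\{x\in E^+:\|x\|\le1\}$ is bounded above. $E$ has the weak Nakano property if there is a constant $K\ge1$ such that, for every increasing, order-bounded net $(x_\alpha)$ in $E_{\mathbb R}$ and every $\varepsilon>0$, the set $\{x_\alpha\}$ has an upper bound $u\in E_{\mathbb R}$ with $\|u\|\le K\sup_\alpha\|x_\alpha\|+\varepsilon$; it has the Nakano property if this holds with $K=1$. For $v\in E^+$, $\Delta_v=\{z\in E:|z|\le v\}$; a subset of $E$ is order-bounded if it is contained in some $\Delta_v$. An operator is order-bounded if it maps order-bounded sets to order-bounded sets; $\mathcal B_b(E,F)$ is the space of order-bounded linear operators from $E$ to $F$ (these are automatically bounded), and $\|T\|_b$ is the infimum of the constants $c$ such that, for each $v\in E^+$, there is $w\in F^+$ with $T(\Delta_v)\subset\Delta_w$ and $\|w\|\le c\|v\|$. A real operator $E_{\mathbb R}\to F_{\mathbb R}$ is regular if it is a difference of two positive operators, and $S+iT$ (with $S,T$ real) is regular if $S$ and $T$ are; $\mathcal B_r(E,F)$ is the space of regular operators, and $\|T\|_r=\inf\{\|S\|:S\text{ a positive operator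 from }E\text{ to }F,\ |Tz|\le S(|z|)\ (z\in E)\}$. The lattice multi-norm based on $E$ is $\|(x_1,\dots,x_n)\|_n^L=\|\,|x_1|\vee\cdots\vee|x_n|\,\|$. With respect to it, $B\subset E$ is multi-bounded if $c_B:=\sup\{\|(x_1,\dots,x_n)\|_n^L:x_1,\dots,x_n\in B,\ n\in\mathbb N\}<\infty$. $\mathcal M(E,F)$ is the space of linear maps $T:E\to F$ such that $T(B)$ is multi-bounded for every multi-bounded $B\subset E$, and $\|T\|_{mb}=\sup\{c_{T(B)}:B\text{ multi-bounded},\ c_B\le1\}$. *)

(* Defs.v *)
From HB Require Import structures.
From mathcomp Require Import all_boot all_order all_algebra.
From mathcomp Require Import all_classical all_reals all_analysis.
From mathcomp Require Import complex.

Set Implicit Arguments.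
Unset Strict Implicit.
Unset Printing Implicit Defensive.

Import Order.TTheory GRing.Theory Num.Theory numFieldNormedType.Exports.

Local Open Scope classical_set_scope.
Local Open Scope ring_scope.

(* Real Banach lattices.  HB rejects a structure that inherits directly from
   both Order.Lattice and CompleteNormedModule (the joins with the numeric
   hierarchy are missing), so the order is a field of the mixin, and the
   canonical lattice structure is attached to the carrier afterwards. *)
HB.mixin Record isBanachLattice (R : realType) V
    of CompleteNormedModule R V := {
  bl_le : rel V ;
  bl_meet : V -> V -> V ;
  bl_join : V -> V -> V ;
  bl_le_refl : reflexive bl_le ;
  bl_le_anti : antisymmetric bl_le ;
  bl_le_trans : transitive bl_le ;
  bl_meetP : forall x y z, bl_le x (bl_meet y z) = bl_le x y && bl_le x z ;
  bl_joinP : forall x y z, bl_le (bl_join x y) z = bl_le x z && bl_le y z ;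
  bl_leD2r : forall z x y, bl_le x y -> bl_le (x + z) (y + z) ;
  bl_scaler_ge0 : forall (a : R) x, 0 <= a -> bl_le 0 x -> bl_le 0 (a *: x) ;
  bl_ler_norm : forall x y,
    bl_le (bl_join x (- x)) (bl_join y (- y)) -> `|x| <= `|y|
}.

#[short(type="banachLatticeType")]
HB.structure Definition BanachLattice (R : realType) :=
  { V of CompleteNormedModule R V & isBanachLattice R V }.

HB.instance Definition _ (R : realType) (V : banachLatticeType R) :=
  Order.Le_isPOrder.Build ring_display (BanachLattice.sort V)
    (@bl_le_refl R V) (@bl_le_anti R V) (@bl_le_trans R V).

HB.instance Definition _ (R : realType) (V : banachLatticeType R) :=
  Order.POrder_MeetJoin_isLattice.Build ring_display (BanachLattice.sort V)
    (@bl_meetP R V) (@bl_joinP R V).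

Section Complexification.
Variables (R : realType) (V : banachLatticeType R).

(* The pair (x, y) stands for x + iy.  This is an alias of V * V so that it
   carries a vector space structure over R[i]; the norm to be used on it is
   cnorm below, and not the max norm of the product V * V. *)
Definition cplx : Type := (V * V)%type.

HB.instance Definition _ := GRing.Zmodule.copy cplx (V * V)%type.

Definition cplx_scale (a : R[i]) (z : cplx) : cplx :=
  (complex.Re a *: z.1 - complex.Im a *: z.2,
   complex.Re a *: z.2 + complex.Im a *: z.1).

Fact cplx_scaleA a b z :
  cplx_scale a (cplx_scale b z) = cplx_scale (a * b) z.
Proof.
case: a b z => [a1 a2] [b1 b2] [x y]; rewrite /cplx_scale /=.
congr (_, _); rewrite !(scalerBr, scalerDr, scalerBl, scalerDl, scalerA).
  by rewrite !opprD [X in _ + X]addrC addrACA.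
by rewrite [X in _ + X]addrC addrACA.
Qed.

Fact cplx_scale1 : left_id 1 cplx_scale.
Proof.
by case=> x y; rewrite /cplx_scale /= !scale1r !scale0r subr0 addr0.
Qed.

Fact cplx_scaleDr : right_distributive cplx_scale +%R.
Proof.
case=> a b [x y] [x' y']; rewrite /cplx_scale /=.
by congr (_, _); rewrite !scalerDr ?opprD addrACA.
Qed.

Fact cplx_scaleDl z : {morph cplx_scale^~ z : a b / a + b}.
Proof.
case: z => x y [a b] [a' b']; rewrite /cplx_scale /=.
by congr (_, _); rewrite !scalerDl ?opprD addrACA.
Qed.

HB.instance Definition _ := GRing.Zmodule_isLmodule.Build R[i] cplx
  cplx_scaleA cplx_scale1 cplx_scaleDr cplx_scaleDl.

Definition real_cplx (x : V) : cplx := (x, 0).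

(* |x + iy|.  The supremum exists in every Banach lattice; the default value 0
   is thus never used. *)
Definition cmod (z : cplx) : V :=
  supremum 0 [set cos t *: z.1 + sin t *: z.2 | t in `[0, 2 * pi]%classic].

Definition cnorm (z : cplx) : R := `|cmod z|.

Definition Delta (v : V) : set cplx := [set z | cmod z <= v].

Definition order_bounded (B : set cplx) : Prop :=
  exists v : V, 0 <= v /\ B `<=` Delta v.

Definition dedekind_complete : Prop :=
  forall A : set V, A !=set0 -> has_ubound A -> supremums A !=set0.

(* Moduli are positive, so that the unit 0 plays no role as soon as 0 < n. *)
Definition lattice_multinorm (n : nat) (x : 'I_n -> cplx) : R :=
  `| \big[Order.join/0]_(i < n) cmod (x i) |.

Definition mb_const (B : set cplx) : \bar R :=
  ereal_sup [set c | exists (n : nat) (x : 'I_n.+1 -> cplx),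
    (forall i, B (x i)) /\ c = (lattice_multinorm x)%:E].

Definition multi_bounded (B : set cplx) : Prop := (mb_const B < +oo)%E.

Section Nets.
Variables (I : Type) (le : I -> I -> Prop).

Definition directed : Prop :=
  [/\ inhabited I,
      forall a, le a a,
      forall a b c, le a b -> le b c -> le a c
    & forall a b, exists c, le a c /\ le b c].

Definition increasing_net (x : I -> V) : Prop :=
  directed /\ forall a b, le a b -> x a <= x b.

End Nets.

Definition monotonically_bounded : Prop :=
  forall (I : Type) (le : I -> I -> Prop) (x : I -> V),
    increasing_net le x -> (forall a, 0 <= x a /\ `|x a| <= 1) ->
    has_ubound (range x).

Definition nakano_const (K : R) : Prop :=
  forall (I : Type) (le : I -> I -> Prop) (x : I -> V) (e : R),
    increasing_net le x -> order_bounded (range (real_cplx \o x)) -> 0 < e ->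
    exists u : V, ubound (range x) u /\
      `|u| <= K * sup (range (fun a => `|x a|)) + e.

Definition weak_nakano : Prop := exists K : R, 1 <= K /\ nakano_const K.

Definition nakano : Prop := nakano_const 1.

End Complexification.

Section Operators.
Variables (R : realType) (E F : banachLatticeType R).

Local Notation operator := {linear cplx E -> cplx F}.

Definition order_bounded_operators : set operator :=
  [set T : operator | forall B, order_bounded B -> order_bounded (T @` B)].

(* The constants are required to be nonnegative, which matters only for
   E = {0}. *)
Definition b_norm (T : operator) : \bar R :=
  ereal_inf [set c%:E | c in [set c : R | 0 <= c /\
    forall v : E, 0 <= v ->
      exists w : F, [/\ 0 <= w, T @` Delta v `<=` Delta w
                      & `|w| <= c * `|v| ] ] ].

Definition positive_operator (S : {linear E -> F}) : Prop :=
  forall x : E, 0 <= x -> 0 <= S x.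

Definition real_regular (S : {linear E -> F}) : Prop :=
  exists S1 S2 : {linear E -> F},
    [/\ positive_operator S1, positive_operator S2
      & forall x, S x = S1 x - S2 x].

Definition cplx_map (S : E -> F) (z : cplx E) : cplx F := (S z.1, S z.2).

Definition regular_operators : set operator :=
  [set T : operator | exists S U : {linear E -> F},
    [/\ real_regular S, real_regular U
      & forall z, T z = cplx_map S z + (Complex 0 1 : R[i]) *: cplx_map U z] ].

Definition opnorm (T : cplx E -> cplx F) : \bar R :=
  ereal_sup [set (cnorm (T z))%:E | z in [set z | cnorm z <= 1] ].

Definition r_norm (T : operator) : \bar R :=
  ereal_inf [set opnorm (cplx_map S) | S in
    [set S : {linear E -> F} | positive_operator S /\
      forall z, cmod (T z) <= S (cmod z)] ].

Definition multi_bounded_operators : set operator :=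
  [set T : operator | forall B, multi_bounded B -> multi_bounded (T @` B)].

Definition multi_bounded_norm (T : operator) : \bar R :=
  ereal_sup [set mb_const (T @` B) | B in
    [set B : set (cplx E) | multi_bounded B /\ (mb_const B <= 1)%E] ].

(* Being norms, p and q are in particular finite on D. *)
Definition equivalent_norms_on (D : set operator) (p q : operator -> \bar R) :
    Prop :=
  exists a b : R, [/\ 0 < a, 0 < b & forall T, D T ->
    [/\ p T \is a fin_num, q T \is a fin_num,
        (a%:E * p T <= q T)%E & (q T <= b%:E * p T)%E] ].

End Operators.

Arguments order_bounded_operators {R} E F.
Arguments multi_bounded_operators {R} E F.
Arguments regular_operators {R} E F.
Arguments b_norm {R E F}.
Arguments r_norm {R E F}.
Arguments multi_bounded_norm {R E F}.

(* Main.v *)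
(* Any constant dominating [T] on order intervals also dominates it on finite
   joins, so the multi-bounded norm is at most the order-bounded one.  Conversely
   the finite joins of [|T z|], [|z| <= v], form an increasing net of norm at most
   [||T||_mb ||v||], and an upper bound of this net is what order-boundedness asks
   for.  A monotonically bounded lattice has a uniform constant for such upper
   bounds, by gluing a sequence of bad nets with weights [2^-n].

   In the Dedekind complete case the modulus of [T] is
   [|T| v = sup {sum_j |T v_j| : v_j >= 0, sum_j v_j = v}], which is additive by
   Riesz decomposition and minimal among the bounds of [T] on order intervals.
   The inequality [|T z| <= |T| |z|] amounts to the bilinear statement
   [S x + U y <= A m] when [a S + b U <= A] and [a x + b y <= m] for all
   [a^2 + b^2 = 1].  It is proved without representing the lattices as function
   spaces: folding both pairs along lines through the origin preserves their
   moduli and increases the pairing, and after [n] foldings with successively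
   halved angles both pairs lie in a sector of angle [pi / 2^n], where
   [S x + U y] is at most [A m] up to an error tending to 0. *)
Require Import Defs.
From HB Require Import structures.
From mathcomp Require Import all_boot all_order all_algebra.
From mathcomp Require Import all_classical all_reals all_analysis.
From mathcomp Require Import complex ring lra.

Set Implicit Arguments.
Unset Strict Implicit.
Unset Printing Implicit Defensive.

Import Order.TTheory GRing.Theory Num.Theory numFieldNormedType.Exports.

Local Open Scope classical_set_scope.
Local Open Scope ring_scope.

(** * Linear identities in a module, by reflection *)

Inductive lexpr (R : Type) :=
  | LVar of nat | LZero | LAdd of lexpr R & lexpr R | LOpp of lexpr R
  | LScale of R & lexpr R.

Arguments LVar {R}.
Arguments LZero {R}.

Section LinearExpressions.
Variables (R : realType) (V : lmodType R).
Implicit Types (xs : seq V) (e : lexpr R).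

Fixpoint leval xs e : V :=
  match e with
  | LVar i => nth 0 xs i
  | LZero => 0
  | LAdd e1 e2 => leval xs e1 + leval xs e2
  | LOpp e1 => - leval xs e1
  | LScale a e1 => a *: leval xs e1
  end.

(** Indices are compared with [Nat.eqb], which [cbn] evaluates on numerals, so that [lincoefs]
    leaves only identities between scalars. *)
Fixpoint lcoef i e : R :=
  match e with
  | LVar j => if Nat.eqb j i then 1 else 0
  | LZero => 0
  | LAdd e1 e2 => lcoef i e1 + lcoef i e2
  | LOpp e1 => - lcoef i e1
  | LScale a e1 => a * lcoef i e1
  end.

Fixpoint lcoefs_eq n e1 e2 : Prop :=
  match n with
  | 0%N => True
  | n'.+1 => lcoef n' e1 = lcoef n' e2 /\ lcoefs_eq n' e1 e2
  end.

Lemma leval_coef xs e :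
  leval xs e = \sum_(i < size xs) lcoef i e *: nth 0 xs i.
Proof.
elim: e => /= [j||e1 -> e2 ->|e1 ->|a e1 ->].
- have eqbE i : Nat.eqb j i = (j == i).
    by case: PeanoNat.Nat.eqb_spec => [->|/eqP/negbTE]; rewrite ?eqxx.
  case: (ltnP j (size xs)) => [ltj|lej].
    rewrite (bigD1 (Ordinal ltj)) //= eqbE eqxx scale1r big1 ?addr0 // => i.
    by rewrite eqbE -val_eqE /= eq_sym => /negbTE ->; rewrite scale0r.
  rewrite nth_default // big1 // => i _.
  by rewrite eqbE gtn_eqF ?scale0r // (leq_trans _ lej).
- by rewrite big1 // => i _; rewrite scale0r.
- by rewrite -big_split; apply: eq_bigr => i _; rewrite scalerDl.
- by rewrite -sumrN; apply: eq_bigr => i _; rewrite scaleNr.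
- by rewrite scaler_sumr; apply: eq_bigr => i _; rewrite scalerA.
Qed.

Lemma leval_eq xs e1 e2 : lcoefs_eq (size xs) e1 e2 -> leval xs e1 = leval xs e2.
Proof.
rewrite !leval_coef; elim: (size xs) => [_|n IH /= [eqn /IH eqs]].
  by rewrite !big_ord0.
by rewrite !big_ord_recr /= eqs eqn.
Qed.

End LinearExpressions.

Ltac lindex x xs :=
  lazymatch xs with
  | x :: _ => constr:(0%N)
  | _ :: ?xs' => let i := lindex x xs' in constr:(S i)
  end.

Ltac latoms t xs :=
  lazymatch t with
  | ?a + ?b => let xs := latoms a xs in latoms b xs
  | - ?a => latoms a xs
  | _ *: ?a => latoms a xs
  | 0 => xs
  | ?x => match xs with
          | _ => let i := lindex x xs in xs
          | _ => constr:(x :: xs)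
          end
  end.

Ltac lreify R t xs :=
  lazymatch t with
  | ?a + ?b =>
      let e1 := lreify R a xs in let e2 := lreify R b xs in
      constr:(@LAdd R e1 e2)
  | - ?a => let e := lreify R a xs in constr:(@LOpp R e)
  | ?c *: ?a => let e := lreify R a xs in constr:(@LScale R c e)
  | 0 => constr:(@LZero R)
  | ?x => let i := lindex x xs in constr:(@LVar R i)
  end.

(* Linear identities in a module over [R] are checked coefficientwise. *)
Ltac lincoefs R :=
  lazymatch goal with
  | |- @eq ?T ?a ?b =>
      let xs := latoms a (@nil T) in
      let xs := latoms b xs in
      let e1 := lreify (Real.sort R) a xs in
      let e2 := lreify (Real.sort R) b xs in
      apply: (@leval_eq R _ xs e1 e2); cbn [size lcoefs_eq lcoef Nat.eqb]
  end.

Ltac linring R := lincoefs R; do !split; try (ring || lra).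


(** * Order and norm in a Banach lattice *)

Section BanachLatticeTheory.
Variables (R : realType) (V : banachLatticeType R).
Implicit Types (x y z u v w : V) (a b : R).

Lemma bl_subr_ge0 x y : (0 <= y - x) = (x <= y).
Proof.
apply/idP/idP => [/(@bl_leD2r R V x)|/(@bl_leD2r R V (- x))].
  by rewrite add0r subrK.
by rewrite subrr.
Qed.

(** Splits an inequality into a known nonnegative element and a linear identity, the latter being
    left to [linring]. *)
Lemma bl_le_eq x y p : 0 <= p -> y - x = p -> x <= y.
Proof. by move=> p_ge0 e; rewrite -bl_subr_ge0 e. Qed.

Lemma bl_addr_ge0 x y : 0 <= x -> 0 <= y -> 0 <= x + y.
Proof.
move=> x0 y0; apply: le_trans y0 _.
by rewrite -{1}(add0r y); apply: bl_leD2r.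
Qed.

Lemma bl_scaler_ge0 a x : 0 <= a -> 0 <= x -> 0 <= a *: x.
Proof. exact: Defs.bl_scaler_ge0. Qed.

Lemma bl_lerD x y z v : x <= y -> z <= v -> x + z <= y + v.
Proof.
rewrite -(bl_subr_ge0 x) -(bl_subr_ge0 z) => h1 h2.
by apply: (bl_le_eq (bl_addr_ge0 h1 h2)); linring R.
Qed.

Lemma bl_lerN2 x y : (- x <= - y) = (y <= x).
Proof. by rewrite -[LHS]bl_subr_ge0 opprK addrC bl_subr_ge0. Qed.

Lemma bl_lerBlDr x y z : (x - y <= z) = (x <= z + y).
Proof. by rewrite -[LHS]bl_subr_ge0 -[RHS]bl_subr_ge0 opprB addrA. Qed.

Lemma bl_lerBrDr x y z : (x <= y - z) = (x + z <= y).
Proof. by rewrite -[LHS]bl_subr_ge0 -[RHS]bl_subr_ge0 opprD addrA addrAC. Qed.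

Lemma bl_ler_wpZ2l a x y : 0 <= a -> x <= y -> a *: x <= a *: y.
Proof.
rewrite -(bl_subr_ge0 x) => a0 h.
by apply: (bl_le_eq (bl_scaler_ge0 a0 h)); linring R.
Qed.

Lemma bl_ler_wpZ2r x a b : 0 <= x -> a <= b -> a *: x <= b *: x.
Proof.
rewrite -subr_ge0 => x0 h.
by apply: (bl_le_eq (bl_scaler_ge0 h x0)); linring R.
Qed.

Lemma bl_ler_pZ2l a x y : 0 < a -> (a *: x <= a *: y) = (x <= y).
Proof.
move=> a0; apply/idP/idP => [|/(bl_ler_wpZ2l (ltW a0))//].
move=> /(@bl_ler_wpZ2l a^-1); rewrite !scalerK ?gt_eqF//; apply.
by rewrite invr_ge0 ltW.
Qed.

Lemma bl_sumr_ge0 (I : Type) (s : seq I) (P : pred I) (f : I -> V) :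
  (forall i, P i -> 0 <= f i) -> 0 <= \sum_(i <- s | P i) f i.
Proof. by move=> f0; elim/big_rec: _ => // i x /f0; exact: bl_addr_ge0. Qed.

Definition babs x : V := (x `|` - x)%O.

Lemma babs_le x m : (babs x <= m) = (x <= m) && (- x <= m).
Proof. exact: leUx. Qed.

Lemma ler_babs x : x <= babs x. Proof. exact: leUl. Qed.

Lemma lerN_babs x : - x <= babs x. Proof. exact: leUr. Qed.

Lemma babs_ge0 x : 0 <= babs x.
Proof.
have h := bl_lerD (ler_babs x) (lerN_babs x); rewrite subrr in h.
rewrite -(@bl_ler_pZ2l 2) // scaler0.
by apply: (le_trans h); rewrite scaler_nat mulr2n.
Qed.

Lemma ger0_babs x : 0 <= x -> babs x = x.
Proof.
move=> x0; apply: join_l; apply: (le_trans _ x0).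
by rewrite -(oppr0 V) bl_lerN2.
Qed.

Lemma babsD x y : babs (x + y) <= babs x + babs y.
Proof. by rewrite babs_le opprD !bl_lerD ?ler_babs ?lerN_babs. Qed.

Lemma babsZ a x : 0 <= a -> babs (a *: x) = a *: babs x.
Proof.
rewrite le_eqVlt => /orP[/eqP <-|a0].
  by rewrite !scale0r; apply: ger0_babs.
apply/le_anti/andP; split.
  by rewrite babs_le -scalerN !bl_ler_pZ2l ?ler_babs ?lerN_babs.
have le_scaled w : a *: w <= babs (a *: x) -> w <= a^-1 *: babs (a *: x).
  by move=> h; rewrite -(bl_ler_pZ2l _ _ a0) scalerKV ?gt_eqF.
rewrite -[leRHS](scalerKV (lt0r_neq0 a0)) bl_ler_pZ2l// babs_le.
by rewrite !le_scaled ?scalerN ?ler_babs ?lerN_babs.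
Qed.

Lemma bl_norm_le x y : babs x <= y -> `|x| <= `|y|.
Proof.
move=> xy; apply: bl_ler_norm; rewrite -[bl_le _ _]/(babs x <= babs y).
by rewrite [babs y]ger0_babs // (le_trans (babs_ge0 x)).
Qed.

Lemma bl_norm_le0 x y : 0 <= x -> x <= y -> `|x| <= `|y|.
Proof. by move=> x0 xy; apply: bl_norm_le; rewrite ger0_babs. Qed.

Lemma norm_babs x : `|babs x| = `|x|.
Proof.
apply/le_anti/andP; split; last exact: bl_norm_le.
apply: bl_ler_norm; rewrite -[bl_le _ _]/(babs (babs x) <= babs x).
by rewrite ger0_babs ?babs_ge0.
Qed.

Definition bpos x : V := (x `|` 0)%O.

Lemma bpos_ge0 x : 0 <= bpos x. Proof. exact: leUr. Qed.

Lemma ler_bpos x : x <= bpos x. Proof. exact: leUl. Qed.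

Lemma bpos_le x m : (bpos x <= m) = (x <= m) && (0 <= m).
Proof. exact: leUx. Qed.

Lemma bposN x : bpos (- x) = bpos x - x.
Proof.
have le y : bpos (- y) <= bpos y - y.
  rewrite bpos_le bl_subr_ge0 ler_bpos andbT.
  by apply: (bl_le_eq (bpos_ge0 y)); linring R.
apply/le_anti/andP; split=> //.
by have := le (- x); rewrite opprK bl_lerBlDr.
Qed.

Lemma bposB x : bpos x - bpos (- x) = x.
Proof. by rewrite bposN opprB addrC subrK. Qed.

Lemma babsE x : babs x = bpos x + bpos (- x).
Proof.
apply/le_anti/andP; split.
  rewrite babs_le -{1}(addr0 x) -{2}(add0r (- x)).
  by rewrite !bl_lerD ?ler_bpos ?bpos_ge0.
(* By [bposN] and halving, the claim says that [bpos x] is at most half of [babs x + x], which is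
   checked against [x] and [0] separately. *)
rewrite bposN -(@bl_ler_pZ2l 2^-1) // ?invr_gt0 //.
have -> : 2^-1 *: (bpos x + (bpos x - x)) = bpos x - 2^-1 *: x by linring R.
rewrite bl_lerBlDr bpos_le.
have h1 := bl_scaler_ge0 (_ : 0 <= 2^-1 :> R) (_ : 0 <= babs x - x).
have h2 := bl_scaler_ge0 (_ : 0 <= 2^-1 :> R) (_ : 0 <= babs x - - x).
apply/andP; split.
  apply: (bl_le_eq (h1 _ _)); rewrite ?bl_subr_ge0 ?ler_babs //; linring R.
apply: (bl_le_eq (h2 _ _)); rewrite ?bl_subr_ge0 ?lerN_babs //; linring R.
Qed.

(** The cone is closed: for [y >= 0] the negative part of [x] lies below [babs (y - x)], so its norm
    is at most the distance from [x] to [y]. *)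
Lemma bl_closed_ge0 x :
  (forall e : R, 0 < e -> exists2 y, 0 <= y & `|x - y| <= e) -> 0 <= x.
Proof.
move=> approx; have : bpos (- x) = 0.
  apply/normr0_eq0/le_anti; rewrite normr_ge0 andbT.
  apply/ler_addgt0Pr => e e0; rewrite add0r.
  have [y y0 xy] := approx _ e0; apply: le_trans xy.
  rewrite distrC -norm_babs; apply: bl_norm_le0; first exact: bpos_ge0.
  rewrite bpos_le babs_ge0 andbT; apply: le_trans (ler_babs _).
  by apply: (bl_le_eq y0); linring R.
move=> h; have := ler_bpos (- x); rewrite h => xN.
by rewrite -bl_lerN2 oppr0.
Qed.

Lemma bl_closed_le x y :
  (forall e : R, 0 < e -> exists2 z, x <= z & `|z - y| <= e) -> x <= y.
Proof.
move=> approx; rewrite -bl_subr_ge0; apply: bl_closed_ge0 => e /approx[z xz zy].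
exists (z - x); rewrite ?bl_subr_ge0 // opprB addrA subrK.
by rewrite distrC.
Qed.

Lemma bl_archimedean x y u :
  (forall e : R, 0 < e -> x <= y + e *: u) -> x <= y.
Proof.
move=> h; apply: bl_closed_le => e e0.
have n0 : 0 < `|u| + 1 by rewrite ltr_wpDl.
exists (y + (e / (`|u| + 1)) *: u); first by apply: h; rewrite divr_gt0.
rewrite addrAC subrr add0r normrZ ger0_norm ?divr_ge0 ?(ltW e0) ?(ltW n0)//.
by rewrite mulrAC ler_pdivrMr// ler_pM2l// lerDl.
Qed.

End BanachLatticeTheory.

(** * The complex modulus *)

Section BigJoin.
Variables (d : Order.disp_t) (L : latticeType d).

Lemma le_bigjoin_idx (I : Type) (r : seq I) (z : L) (f : I -> L) :
  (z <= \big[Order.join/z]_(i <- r) f i)%O.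
Proof. by elim/big_rec: _ => // i x _ zx; rewrite lexU2 // zx orbT. Qed.

Lemma le_bigjoin (I : eqType) (r : seq I) (z : L) (f : I -> L) i :
  i \in r -> (f i <= \big[Order.join/z]_(i <- r) f i)%O.
Proof.
elim: r => // j r IH; rewrite inE big_cons => /predU1P[->|/IH fi].
  exact: leUl.
by rewrite lexU2 // fi orbT.
Qed.

Lemma bigjoin_le (I : Type) (r : seq I) (P : pred I) (z w : L) (f : I -> L) :
  (z <= w)%O -> (forall i, P i -> f i <= w)%O ->
  (\big[Order.join/z]_(i <- r | P i) f i <= w)%O.
Proof. by move=> zw fw; elim/big_ind: _ => // x y xw yw; rewrite leUx xw. Qed.

End BigJoin.

Section Circle.
Variable R : realType.
Implicit Types a b : R.

Definition circle a b : Prop := a ^+ 2 + b ^+ 2 = 1.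

Lemma circle_trig t : circle (cos t) (sin t).
Proof. exact: cos2Dsin2. Qed.

Lemma circle_bound a b : circle a b -> -1 <= a <= 1.
Proof. by rewrite /circle => h; apply/andP; split; nra. Qed.

Lemma circle_angle a b : circle a b ->
  exists2 t, t \in `[0, 2 * pi] & a = cos t /\ b = sin t.
Proof.
move=> ab; have a1 := circle_bound ab.
have ca : cos (acos a) = a by rewrite acosK // in_itv.
have b2 : b ^+ 2 = 1 - a ^+ 2 by rewrite -ab addrAC subrr add0r.
have sa : sin (acos a) = `|b| by rewrite sin_acos// -b2 sqrtr_sqr.
have acos0 := acos_ge0 a1; have acospi := acos_lepi a1.
have [b0|b0] := leP 0 b.
  exists (acos a); last by rewrite ca sa ger0_norm.
  by rewrite in_itv /= acos0 /=; lra.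
(* The lower half of the circle is reached by reflecting the angle [acos a]. *)
exists (2 * pi - acos a).
  by rewrite in_itv /=; apply/andP; split; lra.
rewrite mulr_natl addrC cosD2pi sinD2pi cosN sinN ca sa.
by rewrite ltr0_norm ?opprK.
Qed.

(* Two points of the circle lying in the same cell of a grid of mesh [1 / N.+1]
   are close, so one point per non-empty cell is a finite net. *)
Lemma circle_net (e : R) : 0 < e -> exists (I : finType) (p : I -> R * R),
  (forall i, circle (p i).1 (p i).2) /\
  forall a b, circle a b -> exists i,
    `|a - (p i).1| <= e /\ `|b - (p i).2| <= e.
Proof.
move=> e0; set N := (Num.truncn e^-1).+1.
have N0 : 0 < N%:R :> R by rewrite ltr0n.
have Ne : N%:R^-1 <= e.
  rewrite -[leRHS]invrK lef_pV2 ?posrE ?invr_gt0//.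
  by have /andP[_ /ltW] := truncn_itv (ltW (eqbRL (invr_gt0 e) e0)).
pose cell a := Num.truncn (N%:R * (a + 1)).
have cellK a a' : -1 <= a -> -1 <= a' -> cell a = cell a' -> `|a - a'| <= e.
  move=> a1 a1' eqc; apply: le_trans Ne.
  have h b : -1 <= b -> 0 <= N%:R * (b + 1).
    by move=> b1; rewrite mulr_ge0 ?ler0n //; lra.
  have /andP[] := truncn_itv (h _ a1); have /andP[] := truncn_itv (h _ a1').
  rewrite -!/(cell _) eqc -natr1; set k := (cell a')%:R => h1 h2 h3 h4.
  rewrite -[leRHS]mul1r ler_pdivlMr// -{1}(gtr0_norm N0) -normrM ler_norml.
  by apply/andP; split; nra.
have cell_lt a : -1 <= a <= 1 -> (cell a < (2 * N).+1)%N.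
  case/andP=> a1 a2; rewrite ltnS -(ler_nat R).
  apply: (@le_trans _ _ (N%:R * (a + 1))).
    by rewrite truncn_le mulr_ge0 ?ler0n //; lra.
  by rewrite mulnC natrM ler_pM2l //; lra.
pose S i j := [set q : R * R |
  [/\ circle q.1 q.2, cell q.1 = i & cell q.2 = j]].
exists ('I_(2 * N).+1 * 'I_(2 * N).+1)%type.
(* The default [(1, 0)] lies on the circle, so that empty cells receive an admissible point too. *)
exists (fun k : 'I_(2 * N).+1 * 'I_(2 * N).+1 =>
  xget ((1, 0) : R * R) (S k.1 k.2)); split.
  move=> k; case: xgetP => [q _ []//|_] /=.
  by rewrite /circle expr1n expr0n addr0.
move=> a b ab; have a1 := circle_bound ab.
have b1 : -1 <= b <= 1 by apply: (@circle_bound b a); rewrite /circle addrC.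
exists (Ordinal (cell_lt _ a1), Ordinal (cell_lt _ b1)) => /=.
case: xgetP => [q _ [q1 /esym qa /esym qb]|/(_ (a, b))[]//].
have /andP[p1 _] := circle_bound q1.
have /andP[p2 _] : -1 <= q.2 <= 1.
  by apply: (@circle_bound _ q.1); rewrite /circle addrC.
by case/andP: a1 b1 => a1 _ /andP[b1 _]; split; apply: cellK.
Qed.

End Circle.

Section Modulus.
Variables (R : realType) (V : banachLatticeType R).
Implicit Types (x y m u : V) (z : cplx V) (a b : R).

Lemma bl_lerZ_babs a x : a *: x <= `|a| *: babs x.
Proof.
have [a0|a0] := leP 0 a; first by rewrite ger0_norm // bl_ler_wpZ2l // ler_babs.
rewrite ltr0_norm // -[a *: x]opprK -scaleNr -scalerN.
by rewrite bl_ler_wpZ2l ?lerN_babs // oppr_ge0 ltW.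
Qed.

(** Norm completeness replaces order completeness here. The lower bounds [m] obtained for
    [e = n.+1%:R^-1] differ by at most multiples of [u] tending to 0, hence form a Cauchy sequence;
    its limit is the supremum because the cone is closed. *)
Lemma supremum_of_approx (P : set V) u :
  (forall e : R, 0 < e -> exists m,
     (forall w, ubound P w -> m <= w) /\ forall p, P p -> p <= m + e *: u) ->
  0 <= u -> supremums P !=set0.
Proof.
move=> approx u0.
have pos n : 0 < n.+1%:R^-1 :> R by rewrite invr_gt0 ltr0n.
have [m mP] := choice (fun n => approx _ (pos n)).
have m_le j k : m j <= m k + k.+1%:R^-1 *: u.
  by have [+ _] := mP j; apply => p Pp; have [_] := mP k; apply.
have sc n : 0 <= n.+1%:R^-1 *: u by apply: bl_scaler_ge0 => //; exact: ltW.
have small (e : R) : 0 < e ->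
    exists N, forall n, (N <= n)%N -> n.+1%:R^-1 * `|u| <= e.
  move=> e0; exists (Num.truncn (`|u| / e)) => n Nn.
  rewrite mulrC ler_pdivrMr ?ltr0n// -ler_pdivrMl// mulrC.
  have /andP[_ /ltW] := truncn_itv (divr_ge0 (normr_ge0 u) (ltW e0)).
  by move=> /le_trans; apply; rewrite ler_nat ltnS.
have mcvg : cvgn m.
  apply/cauchy_cvgP/cauchy_exP => e e0.
  have [N Nle] := small _ (divr_gt0 e0 (ltr0Sn R 3)).
  exists (m N); exists N => // n /= Nn; rewrite -ball_normE /=.
  apply: (@le_lt_trans _ _ (e / 4 + e / 4)); last by lra.
  apply: (@le_trans _ _ `|N.+1%:R^-1 *: u + n.+1%:R^-1 *: u|).
    have le_sum i j : m i - m j <= i.+1%:R^-1 *: u + j.+1%:R^-1 *: u.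
      rewrite bl_lerBlDr (le_trans (m_le i j)) //.
      by apply: (bl_le_eq (sc i)); linring R.
    apply: bl_norm_le; rewrite babs_le opprB le_sum /=.
    by rewrite [_ *: u + _]addrC le_sum.
  apply: le_trans (ler_normD _ _) _.
  by rewrite !normrZ !gtr0_norm// lerD// Nle.
have limP e : 0 < e -> exists n, `|m n - limn m| <= e /\ n.+1%:R^-1 * `|u| <= e.
  move=> e0; have [N Nle] := small _ e0.
  have /cvgrPdist_le /(_ _ e0) [N' _ N'le] := mcvg.
  exists (maxn N N'); rewrite Nle ?leq_maxl//; split=> //.
  by rewrite distrC N'le //= leq_maxr.
exists (limn m); split=> [p Pp|w Pw].
  apply: bl_closed_le => e e0; have [n [h1 h2]] := limP _ (divr_gt0 e0 (ltr0Sn R 1)).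
  exists (m n + n.+1%:R^-1 *: u); first by have [_] := mP n; apply.
  rewrite addrAC (le_trans (ler_normD _ _)) // normrZ gtr0_norm //.
  by apply: le_trans (lerD h1 h2) _; lra.
rewrite -bl_subr_ge0; apply: bl_closed_ge0 => e /limP[n [h _]].
exists (w - m n); first by rewrite bl_subr_ge0; have [+ _] := mP n; apply.
by have -> : w - limn m - (w - m n) = m n - limn m by linring R.
Qed.

(** Expresses [|x + iy| <= m] without a supremum, a form that also suits the values of a pair of
    operators. *)
Definition circle_ub x y m : Prop :=
  forall a b, circle a b -> a *: x + b *: y <= m.

(** The join over a finite net of the circle lies below every upper bound, and each element of the
    set exceeds it by at most [e *: (babs x + babs y)]. *)
Lemma circle_supremum x y :
  supremums [set p.1 *: x + p.2 *: y | p in [set p : R * R | circle p.1 p.2]]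
    !=set0.
Proof.
have u0 : 0 <= babs x + babs y by rewrite bl_addr_ge0 // babs_ge0.
apply: supremum_of_approx u0 => e e0.
have [I [p [pC pnet]]] := circle_net e0.
have c1 : circle (1 : R) 0 by rewrite /circle expr1n expr0n addr0.
exists (\big[Order.join/1 *: x + 0 *: y]_(i <- enum I)
   ((p i).1 *: x + (p i).2 *: y))%O; split=> [w wub|_ [[a b] /= ab <-]].
  apply: bigjoin_le => [|i _]; apply: wub; first by exists (1, 0).
  by exists (p i) => //; exact: pC.
have [i [ha hb]] := pnet _ _ ab.
have := le_bigjoin (1 *: x + 0 *: y) (fun i => (p i).1 *: x + (p i).2 *: y)
  (mem_enum I i).
set M := \big[_/_]_(_ <- _) _ => piM.
have le_e (c c' : R) (w : V) : `|c - c'| <= e -> (c - c') *: w <= e *: babs w.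
  move=> cc; apply: le_trans (bl_lerZ_babs _ _) _.
  by rewrite bl_ler_wpZ2r ?babs_ge0.
rewrite scalerDr.
apply: le_trans (_ : _ <= M + ((a - (p i).1) *: x + (b - (p i).2) *: y)) _.
  by move: piM; rewrite -bl_subr_ge0 => h; apply: (bl_le_eq h); linring R.
by rewrite bl_lerD // bl_lerD // le_e.
Qed.

Lemma cmodP z : supremums
  [set p.1 *: z.1 + p.2 *: z.2 | p in [set p : R * R | circle p.1 p.2]] (cmod z).
Proof.
have eqS : [set cos t *: z.1 + sin t *: z.2 | t in `[0, 2 * pi]%classic] =
    [set p.1 *: z.1 + p.2 *: z.2 | p in [set p : R * R | circle p.1 p.2]].
  apply/seteqP; split=> [_ [t _ <-]|_ [[a b] /= ab <-]].
    by exists (cos t, sin t) => //=; exact: circle_trig.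
  have [t t2 [-> ->]] := circle_angle ab; by exists t.
rewrite /cmod /supremum eqS; case: eqP => [S0|_].
  (* The point [(1, 0)] shows that the set is nonempty, which rules out the default branch of
     [supremum]. *)
  have : circle (1 : R) 0 by rewrite /circle expr1n expr0n addr0.
  move=> c1; exfalso; rewrite -[False]/(set0 (1 *: z.1 + 0 *: z.2)) -S0.
  by exists (1, 0).
by have [s] := circle_supremum z.1 z.2; exact: xgetI.
Qed.

Lemma cmod_le z m : cmod z <= m <-> circle_ub z.1 z.2 m.
Proof.
have [ub lub] := cmodP z; split=> [zm a b ab|zm].
  by apply: le_trans zm; apply: ub; exists (a, b).
by apply: lub => _ [[a b] ab <-]; exact: zm.
Qed.

Lemma cmod_ub z : circle_ub z.1 z.2 (cmod z).
Proof. exact/cmod_le. Qed.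

(** The new pair is [(a - ib)(c + is)], and the modulus of complex numbers is multiplicative. *)
Lemma circle_rot a b c s : circle c s -> circle a b ->
  circle (a * c + b * s) (a * s - b * c).
Proof.
rewrite /circle => cs ab; transitivity ((a ^+ 2 + b ^+ 2) * (c ^+ 2 + s ^+ 2)).
  by ring.
by rewrite cs ab mulr1.
Qed.

Lemma circle_ub_babs x y m : circle_ub x y m -> babs x <= m /\ babs y <= m.
Proof.
move=> xym; rewrite !babs_le.
have h a b : circle a b -> a *: x + b *: y <= m by exact: xym.
have e (c : R) : c ^+ 2 = 1 -> c *: x <= m /\ c *: y <= m.
  move=> c1; split.
    by have := h c 0; rewrite scale0r addr0; apply; rewrite /circle c1 expr0n addr0.
  by have := h 0 c; rewrite scale0r add0r; apply; rewrite /circle c1 expr0n add0r.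
have [] := e 1 (expr1n _ _); have [] := e (-1) _; first by rewrite sqrrN expr1n.
by rewrite !scale1r !scaleN1r => -> -> -> ->.
Qed.

Lemma cmod_ge0 z : 0 <= cmod z.
Proof. by have [/(le_trans (babs_ge0 _))] := circle_ub_babs (@cmod_ub z). Qed.

Lemma re_le_cmod z : z.1 <= cmod z.
Proof.
have [h _] := circle_ub_babs (@cmod_ub z).
exact: le_trans (ler_babs _) h.
Qed.

Lemma cmodD z z' : cmod (z + z') <= cmod z + cmod z'.
Proof.
apply/cmod_le => a b ab.
have h := bl_lerD (cmod_ub z ab) (cmod_ub z' ab).
apply: le_trans h; rewrite le_eqVlt; apply/orP/or_introl/eqP => /=.
linring R.
Qed.

Lemma cmod_real x : cmod (real_cplx x) = babs x.
Proof.
apply/le_anti/andP; split; last by case: (circle_ub_babs (@cmod_ub (x, 0))).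
apply/cmod_le => a b ab; rewrite scaler0 addr0.
apply: le_trans (bl_lerZ_babs _ _) _.
rewrite -[leRHS]scale1r bl_ler_wpZ2r ?babs_ge0 //.
by rewrite ler_norml; exact: circle_bound ab.
Qed.

Lemma cmodZ (a : R) z : 0 <= a -> cmod (a *: z.1, a *: z.2) = a *: cmod z.
Proof.
have le (c : R) (w : cplx V) : 0 <= c -> cmod (c *: w.1, c *: w.2) <= c *: cmod w.
  move=> c0; apply/cmod_le => p q pq /=.
  have h := bl_ler_wpZ2l c0 (cmod_ub w pq).
  by apply: le_trans h; rewrite le_eqVlt; apply/orP/or_introl/eqP; linring R.
rewrite le_eqVlt => /predU1P[<-|a0].
  apply/le_anti/andP; split; first exact: le.
  by rewrite scale0r cmod_ge0.
apply/le_anti/andP; split; first by rewrite le // ltW.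
have := @le a^-1 (a *: z.1, a *: z.2); rewrite /= !scalerK ?gt_eqF //.
rewrite invr_ge0 ltW // => /(_ isT) h.
rewrite -[leRHS](@scalerKV _ _ a) ?gt_eqF // bl_ler_pZ2l //.
Qed.

Lemma cmod0 : cmod (0 : cplx V) = 0.
Proof. by have := cmodZ (0 : cplx V) (lexx 0); rewrite !scale0r. Qed.

Lemma cmod_eq0 z : cmod z = 0 -> z = 0.
Proof.
have babs0 x : babs x <= 0 -> x = 0.
  move=> h; apply/normr0_eq0/le_anti; rewrite normr_ge0 andbT.
  by rewrite -(normr0 V); exact: bl_norm_le.
move=> z0; have [] := circle_ub_babs (@cmod_ub z); rewrite z0 => /babs0 h1 /babs0 h2.
by case: z h1 h2 {z0} => ? ? /= -> ->.
Qed.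

End Modulus.

(** * Directed sets *)

Section PowersOfTwo.
Variable R : realType.

Lemma expr2_gt0 n : 0 < 2 ^+ n :> R. Proof. exact: exprn_gt0. Qed.

Lemma sum_expV2 n : \sum_(i < n) (2 ^+ i.+1)^-1 = 1 - (2 ^+ n)^-1 :> R.
Proof.
elim: n => [|n IH]; first by rewrite big_ord0 expr0 invr1 subrr.
rewrite big_ord_recr /= IH exprS invfM -addrA; congr (_ + _).
by set t := _^-1 in |- *; lra.
Qed.

Lemma natr_unbounded (x : R) : ~ forall n : nat, n%:R <= x.
Proof.
move=> h; have x0 : 0 <= x by exact: h 0%N.
by have /andP[_] := truncn_itv x0; rewrite ltNge h.
Qed.

End PowersOfTwo.

Section Summable.
Variables (R : realType) (V : banachLatticeType R).

(** The series converges absolutely, and its sum dominates each term since the other terms are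
    nonnegative. *)
Lemma summable_ub (u : nat -> V) : (forall n, 0 <= u n) ->
  (forall n, `|u n| <= (2 ^+ n.+1)^-1) -> exists l, forall n, u n <= l.
Proof.
move=> u0 un.
have ucvg : cvgn (series u).
  apply: normed_cvg; apply: (@series_le_cvg _ _ (fun n => (2 ^+ n.+1)^-1)) => //.
  by move=> n /=.
  have -> : (fun n => (2 ^+ n.+1)^-1) = geometric 2^-1 2^-1 :> (R^nat).
    by apply/funext => n /=; rewrite -exprS exprVn.
  by apply: is_cvg_geometric_series; rewrite ger0_norm; lra.
exists (limn (series u)) => n; apply: bl_closed_le => e e0.
have /cvgrPdist_le /(_ _ e0) [N _ Nle] := ucvg.
exists (series u (maxn n.+1 N)); last by rewrite distrC; apply: Nle; exact: leq_maxr.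
rewrite /series /= big_mkord (bigD1 (Ordinal (leq_maxl n.+1 N))) //=.
rewrite -[X in X <= _]addr0 bl_lerD //.
by apply: bl_sumr_ge0 => i _; exact: u0.
Qed.

End Summable.

Section DirectedSets.
Variables (R : realType) (V : banachLatticeType R).
Implicit Types (A : set V) (x y u w : V).

Definition directed_set A : Prop :=
  A !=set0 /\ forall x y, A x -> A y -> exists z, [/\ A z, x <= z & y <= z].

(** A directed set is a net indexed by itself; this makes the hypotheses on nets applicable to sets
    of finite joins. *)
Lemma directed_set_net A : directed_set A ->
  increasing_net (fun a b : {x : V | A x} => sval a <= sval b) sval.
Proof.
move=> [[x0 Ax0] dirA]; split=> //; split.
- by constructor; exists x0.
- by move=> a.
- by move=> a b c /le_trans; apply.
- move=> [x Ax] [y Ay]; have [z [Az xz yz]] := dirA _ _ Ax Ay.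
  by exists (exist _ z Az).
Qed.

Lemma range_sval A : range (sval : {x : V | A x} -> V) = A.
Proof.
apply/seteqP; split=> [_ [[x Ax] _ <-] //|x Ax].
by exists (exist _ x Ax).
Qed.

Lemma monotonically_bounded_directed A : monotonically_bounded V ->
  directed_set A -> (forall x, A x -> 0 <= x /\ `|x| <= 1) -> has_ubound A.
Proof.
move=> mbV /directed_set_net netA A1.
have := mbV _ _ _ netA; rewrite range_sval; apply => -[x Ax]; exact: A1.
Qed.

Lemma nakano_directed K A c w (e : R) : nakano_const V K -> 0 <= K ->
  directed_set A -> (forall x, A x -> 0 <= x /\ `|x| <= c) ->
  (forall x, A x -> x <= w) -> 0 < e ->
  exists2 u, ubound A u & `|u| <= K * c + e.
Proof.
move=> nakV K0 dirA Ac Aw e0.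
have [x0 Ax0] := dirA.1.
have ob : order_bounded (range (@real_cplx R V \o (sval : {x : V | A x} -> V))).
  exists w; split; first by have [x0_ge0 _] := Ac _ Ax0; exact: le_trans (Aw _ Ax0).
  move=> _ [[x Ax] _ <-]; rewrite /Delta /= cmod_real ger0_babs ?Aw //.
  by have [] := Ac _ Ax.
have [u [+ ule]] := nakV _ _ _ _ (directed_set_net dirA) ob e0.
rewrite range_sval => Au.
exists u => //; apply: (le_trans ule).
rewrite lerD2r ler_wpM2l //; apply: ge_sup.
  by exists `|x0|; exists (exist _ x0 Ax0).
by move=> _ [[x Ax] _ <-]; have [] := Ac _ Ax.
Qed.

(** If no constant worked, there would be directed sets [A n] in the positive unit ball whose upper
    bounds all have norm above [n.+1%:R * 2 ^+ n.+1]. The finite sums of [2^-(i+1) a_i] with [a_i]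
    in [A i] form a directed set in that ball, and an upper bound [u] of it makes [2 ^+ n.+1 *: u]
    an upper bound of [A n], so that [n.+1%:R < |u|] in norm for every [n]. *)
Lemma monotonically_bounded_const : monotonically_bounded V ->
  exists2 M : R, 0 < M & forall A, directed_set A ->
    (forall x, A x -> 0 <= x /\ `|x| <= 1) -> exists2 u, ubound A u & `|u| <= M.
Proof.
move=> mbV; apply: contrapT => noM.
have large n : exists A, [/\ directed_set A,
    (forall x, A x -> 0 <= x /\ `|x| <= 1)
    & forall u, ubound A u -> n.+1%:R * 2 ^+ n.+1 < `|u|].
  apply: contrapT => noA; apply: noM.
  exists (n.+1%:R * 2 ^+ n.+1); first by rewrite mulr_gt0 ?ltr0n ?expr2_gt0.
  move=> A dirA A1; apply: contrapT => nou; apply: noA; exists A; split=> // u uA.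
  by rewrite ltNge; apply/negP => ule; apply: nou; exists u.
have [A AP] := choice large.
have dirA n : directed_set (A n) by have [] := AP n.
have A0 n x : A n x -> 0 <= x by have [_ + _] := AP n => /[apply] -[].
have A1 n x : A n x -> `|x| <= 1 by have [_ + _] := AP n => /[apply] -[].
have [a0 a0P] := choice (fun n => (dirA n).1).
pose S n (a : nat -> V) := \sum_(i < n) (2 ^+ i.+1)^-1 *: a i.
(* The length [n] varies along with the choice [a]: a longer sum only adds nonnegative terms, so two
   sums compare at the larger length. *)
pose P := [set S n a | n in setT & a in [set a | forall i, A i (a i)]].
have c0 n : 0 <= (2 ^+ n)^-1 :> R by rewrite invr_ge0 ltW // expr2_gt0.
have S_mono n m a b : (n <= m)%N -> (forall i, A i (b i)) ->
    (forall i, a i <= b i) -> S n a <= S m b.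
  move=> nm Ab ab; rewrite /S (big_ord_widen m (fun i => (2 ^+ i.+1)^-1 *: a i)) //.
  rewrite [leRHS](bigID (fun i : 'I_m => (i < n)%N)) /= -[leLHS]addr0.
  apply: bl_lerD.
    by elim/big_ind2: _ => // [*|i _]; [exact: bl_lerD|exact: bl_ler_wpZ2l].
  by apply: bl_sumr_ge0 => i _; rewrite bl_scaler_ge0 // (A0 i).
have [] := @monotonically_bounded_directed P mbV.
- split; first by exists (S 0%N a0), 0%N => //; exists a0.
  move=> _ _ [n _ [a Aa <-]] [m _ [b Ab <-]].
  have [c cP] := choice (fun i => (dirA i).2 _ _ (Aa i) (Ab i)).
  exists (S (maxn n m) c); split.
  + by exists (maxn n m) => //; exists c => // i; have [] := cP i.
  + by apply: S_mono => [|i|i]; rewrite ?leq_maxl //; have [] := cP i.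
  + by apply: S_mono => [|i|i]; rewrite ?leq_maxr //; have [] := cP i.
- move=> _ [n _ [a Aa <-]]; split.
    by apply: bl_sumr_ge0 => i _; rewrite bl_scaler_ge0 // (A0 i).
  apply: le_trans (ler_norm_sum _ _ _) _.
  apply: (@le_trans _ _ (\sum_(i < n) (2 ^+ i.+1)^-1)).
    apply: ler_sum => i _; rewrite normrZ ger0_norm //.
    by rewrite ler_piMr // (A1 i).
  by rewrite sum_expV2 lerBlDr lerDl.
move=> u uP; apply: (@natr_unbounded R `|u|) => n.
have uA : ubound (A n) (2 ^+ n.+1 *: u).
  move=> x Ax; rewrite -(@bl_ler_pZ2l _ _ (2 ^+ n.+1)^-1) ?invr_gt0 ?expr2_gt0 //.
  rewrite scalerK ?gt_eqF ?expr2_gt0 //.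
  (* Put in position [n], the arbitrary [x] becomes, up to its weight, a summand of an element of
     [P]; the other summands are nonnegative. *)
  pose a i := if i == n then x else a0 i.
  have Aa i : A i (a i) by rewrite /a; case: eqP => [->|].
  have : P (S n.+1 a) by exists n.+1 => //; exists a.
  move/uP; apply: le_trans; rewrite /S big_ord_recr /= {2}/a eqxx.
  rewrite -[leLHS]add0r bl_lerD //.
  by apply: bl_sumr_ge0 => i _; rewrite bl_scaler_ge0 // (A0 i).
have [_ _ /(_ _ uA)] := AP n.
rewrite normrZ ger0_norm ?(ltW (expr2_gt0 _ _)) // mulrC ltr_pM2l ?expr2_gt0 //.
by move/ltW; apply: le_trans; rewrite ler_nat.
Qed.

End DirectedSets.

(** * Multi-bounded sets and order-bounded operators *)

Section FiniteJoins.
Variables (R : realType) (V : banachLatticeType R).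
Implicit Types (B : set (cplx V)) (v w : V) (z : cplx V).

Lemma cplx_scaleE (c : R[i]) z :
  c *: z = (complex.Re c *: z.1 - complex.Im c *: z.2,
            complex.Re c *: z.2 + complex.Im c *: z.1).
Proof. by []. Qed.

Lemma cplx_scale_real (a : R) z : (a%:C)%C *: z = (a *: z.1, a *: z.2) :> cplx V.
Proof. by rewrite cplx_scaleE /= !scale0r subr0 addr0. Qed.

Lemma mb_const_ge0 B z : B z -> (0 <= mb_const B)%E.
Proof.
move=> Bz; apply: (@le_trans _ _ (lattice_multinorm (fun _ : 'I_1 => z))%:E).
  by rewrite lee_fin normr_ge0.
by apply: ereal_sup_ubound; exists 0%N, (fun=> z).
Qed.

Lemma mb_const_Delta v : 0 <= v -> (mb_const (Delta v) <= `|v|%:E)%E.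
Proof.
move=> v0; apply: ge_ereal_sup => _ [n [x [xv ->]]]; rewrite lee_fin.
apply: bl_norm_le0; first exact: le_bigjoin_idx.
by apply: bigjoin_le => // i _; exact: xv.
Qed.

Lemma order_bounded_multi_bounded B : order_bounded B -> multi_bounded B.
Proof.
move=> [v [v0 Bv]]; apply: (@le_lt_trans _ _ `|v|%:E); last exact: ltry.
apply: le_trans (mb_const_Delta v0); apply: le_ereal_sup => _ [n [x [Bx ->]]].
by exists n, x; split=> // i; exact: Bv.
Qed.

(** The empty sequence contributes [0], which makes the set nonempty for every [B] and its upper
    bounds nonnegative. *)
Definition finite_joins B : set V :=
  [set \big[Order.join/0]_(z <- s) cmod z
     | s in [set s : seq (cplx V) | forall z, z \in s -> B z]].

Lemma finite_joins_directed B : directed_set (finite_joins B).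
Proof.
split; first by exists (\big[Order.join/0]_(z <- [::]) cmod z), [::].
move=> _ _ [s Bs <-] [t Bt <-].
exists (\big[Order.join/0]_(z <- s ++ t) cmod z); split.
- by exists (s ++ t) => // z; rewrite mem_cat => /orP[/Bs|/Bt].
- rewrite big_seq; apply: bigjoin_le => [|z zs]; first exact: le_bigjoin_idx.
  by apply: le_bigjoin; rewrite mem_cat zs.
- rewrite big_seq; apply: bigjoin_le => [|z zt]; first exact: le_bigjoin_idx.
  by apply: le_bigjoin; rewrite mem_cat zt orbT.
Qed.

Lemma finite_joins_ge0 B x : finite_joins B x -> 0 <= x.
Proof. by move=> [s _ <-]; exact: le_bigjoin_idx. Qed.

Lemma finite_joins_norm B x c : 0 <= c -> (mb_const B <= c%:E)%E ->
  finite_joins B x -> `|x| <= c.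
Proof.
(* [mb_const] counts nonempty families only, so the empty join is bounded by means of [c0]. *)
move=> c0 Bc [[|z0 s] Bs <-]; first by rewrite big_nil normr0.
rewrite -lee_fin; apply: le_trans Bc; apply: ereal_sup_ubound.
exists (size s), (fun i => nth z0 (z0 :: s) i); split.
  by move=> i; apply: Bs; rewrite mem_nth.
by rewrite /lattice_multinorm (big_nth z0) big_mkord.
Qed.

(** Converts the upper bounds of nets provided by the hypotheses on [F] into the sets [Delta w] that
    define order-boundedness. *)
Lemma ubound_finite_joins B w : ubound (finite_joins B) w <-> 0 <= w /\ B `<=` Delta w.
Proof.
split=> [wub|[w0 Bw] _ [s Bs <-]].
  split; first by apply: wub; exists [::]; rewrite ?big_nil.
  move=> z Bz; apply: le_trans (wub (\big[Order.join/0]_(y <- [:: z]) cmod y) _).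
    by apply: le_bigjoin; rewrite inE.
  by exists [:: z] => // y; rewrite inE => /eqP ->.
by rewrite big_seq; apply: bigjoin_le => // z /Bs /Bw.
Qed.

Lemma DeltaZ (a : R) v z : 0 <= a -> Delta v z -> Delta (a *: v) ((a%:C)%C *: z).
Proof. by move=> a0 zv; rewrite /Delta /= cplx_scale_real cmodZ // bl_ler_wpZ2l. Qed.

End FiniteJoins.

Section OperatorNorms.
Variables (R : realType) (E F : banachLatticeType R).
Implicit Types (T : {linear cplx E -> cplx F}) (c : R) (v : E) (w : F).

(** The condition on [c] in [b_norm], apart from [0 <= c]. *)
Definition dominated T c : Prop := forall v, 0 <= v ->
  exists w, [/\ 0 <= w, T @` Delta v `<=` Delta w & `|w| <= c * `|v|].

Lemma image_DeltaZ T (a : R) v w : 0 < a ->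
  T @` Delta v `<=` Delta w -> T @` Delta (a *: v) `<=` Delta (a *: w).
Proof.
move=> a0 Tvw _ [z zv <-].
have -> : z = (a%:C)%C *: ((a^-1%:C)%C *: z : cplx E).
  rewrite [in RHS]cplx_scale_real !cplx_scale_real /= !scalerKV ?gt_eqF //.
  by case: (z).
rewrite linearZ /=; apply: DeltaZ; first exact: ltW.
apply: Tvw; exists ((a^-1%:C)%C *: z : cplx E) => //.
rewrite -[v](scalerK (lt0r_neq0 a0)); apply: DeltaZ => //.
by rewrite invr_ge0 ltW.
Qed.

Lemma image_Delta0 T : T @` Delta 0 `<=` Delta 0.
Proof.
move=> _ [z z0 <-]; have -> : z = 0.
  by apply: cmod_eq0; apply/le_anti; rewrite cmod_ge0 andbT.
by rewrite linear0 /Delta /= cmod0.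
Qed.

(** The condition is homogeneous in [v]; only [v = 0] cannot be normalised, and there [Delta 0] is
    mapped into [Delta 0]. *)
Lemma dominated_unit T c : 0 <= c ->
  (forall v, 0 <= v -> `|v| = 1 ->
     exists w, [/\ 0 <= w, T @` Delta v `<=` Delta w & `|w| <= c]) ->
  dominated T c.
Proof.
move=> c0 dom v v0; have [->|vn0] := eqVneq v 0.
  by exists 0; rewrite !normr0 mulr0; split=> //; exact: image_Delta0.
have nv0 : 0 < `|v| by rewrite normr_gt0.
have [||w [w0 Tw wc]] := dom (`|v|^-1 *: v).
- by rewrite bl_scaler_ge0 ?invr_ge0.
- by rewrite normrZ normfV normr_id mulVf ?normr_eq0.
exists (`|v| *: w); split; first by rewrite bl_scaler_ge0.
  have := image_DeltaZ nv0 Tw; rewrite scalerKV ?normr_eq0 //.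
by rewrite normrZ normr_id mulrC ler_pM2r.
Qed.

(** Otherwise there are unit vectors [u n] for which every admissible [w] has norm above
    [n%:R * 2 ^+ n.+1]. A single [l] dominates all the [2^-(n+1) u_n], and a single [w] bounds [T]
    on [Delta l]; after rescaling, its norm would exceed every [n]. *)
Lemma order_bounded_dominated T :
  order_bounded_operators E F T -> exists2 c, 0 <= c & dominated T c.
Proof.
move=> Tob; apply: contrapT => nodom.
have large n : exists v, [/\ 0 <= v, `|v| = 1 &
    forall w, 0 <= w -> T @` Delta v `<=` Delta w -> n%:R * 2 ^+ n.+1 < `|w| ].
  apply: contrapT => nov; apply: nodom.
  have c0 : 0 <= n%:R * 2 ^+ n.+1 :> R by rewrite mulr_ge0 // ltW // expr2_gt0.
  exists (n%:R * 2 ^+ n.+1) => //; apply: dominated_unit => // v v0 v1.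
  apply: contrapT => now; apply: nov; exists v; split=> // w w0 Tw.
  by rewrite ltNge; apply/negP => wle; apply: now; exists w.
have [u uP] := choice large.
have u0 n : 0 <= (2 ^+ n.+1)^-1 *: u n.
  by rewrite bl_scaler_ge0 ?invr_ge0 ?(ltW (expr2_gt0 _ _)) //; case: (uP n).
have [n|l lP] := summable_ub u0.
  have [_ un _] := uP n.
  by rewrite normrZ ger0_norm ?invr_ge0 ?(ltW (expr2_gt0 _ _)) // un mulr1.
have [w [w0 Tlw]] : order_bounded (T @` Delta l).
  by apply: Tob; exists l; split=> //; exact: le_trans (u0 0%N) (lP 0%N).
apply: (@natr_unbounded R `|w|) => n; have [_ _ uw] := uP n.
have /(image_DeltaZ (expr2_gt0 R n.+1)) :
    T @` Delta ((2 ^+ n.+1)^-1 *: u n) `<=` Delta w.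
  move=> _ [z zu <-]; apply: Tlw; exists z => //.
  exact: le_trans zu (lP n).
rewrite scalerKV ?gt_eqF ?expr2_gt0 // => /uw.
rewrite normrZ ger0_norm ?(ltW (expr2_gt0 _ _)) // bl_scaler_ge0 //.
  by rewrite mulrC ltr_pM2l ?expr2_gt0 // => /(_ isT)/ltW.
Qed.

(** A finite family in the image is lifted to [B]; the join [v] of the moduli of the lifts has norm
    at most [r], and the one [w] attached to [v] bounds the whole family. *)
Lemma dominated_mb_const T c (r : R) B : 0 <= c -> dominated T c ->
  (mb_const B <= r%:E)%E -> (mb_const (T @` B) <= (c * r)%:E)%E.
Proof.
move=> c0 dom Br; apply: ge_ereal_sup => _ [n [x [xB ->]]]; rewrite lee_fin.
have preim i : exists z, B z /\ T z = x i by have [z Bz Tz] := xB i; exists z.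
have [z zP] := choice preim.
set v := \big[Order.join/0]_(i < n.+1) cmod (z i).
have v0 : 0 <= v by exact: le_bigjoin_idx.
have [w [w0 Tw wle]] := dom _ v0.
apply: (@le_trans _ _ `|w|).
  apply: bl_norm_le0; first exact: le_bigjoin_idx.
  apply: bigjoin_le => // i _; have [_ <-] := zP i.
  apply: Tw; exists (z i) => //; rewrite /Delta /= /v.
  exact: (le_bigjoin (0 : E) (fun j => cmod (z j)) (mem_index_enum i)).
apply: le_trans wle _; rewrite ler_wpM2l // -lee_fin; apply: le_trans Br.
apply: ereal_sup_ubound; exists n, z; split=> // i; by have [] := zP i.
Qed.

Lemma dominated_multi_bounded T c : 0 <= c -> dominated T c ->
  multi_bounded_operators E F T.
Proof.
move=> c0 dom B; rewrite /multi_bounded.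
case eqB: (mb_const B) => [r||] // _; last first.
  (* [mb_const] is [-oo] on the empty set; [0] then serves as its real bound. *)
  apply: le_lt_trans (ltry (c * 0)); apply: dominated_mb_const => //.
  by rewrite eqB leNye.
by apply: le_lt_trans (ltry (c * r)); apply: dominated_mb_const; rewrite ?eqB.
Qed.

Lemma b_norm_le T c : 0 <= c -> dominated T c -> (b_norm T <= c%:E)%E.
Proof. by move=> c0 dom; apply: ereal_inf_lbound; exists c. Qed.

Lemma b_norm_ge0 T : (0 <= b_norm T)%E.
Proof. by apply: le_ereal_inf_tmp => _ [c [c0 _] <-]; rewrite lee_fin. Qed.

(** The singleton of [0] is an admissible [B], which keeps the supremum away from [-oo]. *)
Lemma multi_bounded_norm_ge0 T : (0 <= multi_bounded_norm T)%E.
Proof.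
have B0 : (mb_const [set (0%R : cplx E)] <= 0)%E.
  apply: le_trans (_ : _ <= mb_const (Delta (0%R : E)))%E _.
    apply: le_ereal_sup => _ [n [x [x0 ->]]]; exists n, x; split=> // i.
    by rewrite (x0 i) /Delta /= cmod0.
  by apply: le_trans (mb_const_Delta (lexx 0)) _; rewrite normr0.
apply: (@le_trans _ _ (mb_const (T @` [set (0 : cplx E)]))).
  by apply: (@mb_const_ge0 _ _ _ (T 0)); exists 0.
apply: ereal_sup_ubound; exists [set (0 : cplx E)] => //; split.
  by apply: le_lt_trans B0 _; exact: ltry.
by apply: le_trans B0 _; rewrite lee_fin.
Qed.

Lemma multi_bounded_norm_le_b_norm T : (multi_bounded_norm T <= b_norm T)%E.
Proof.
apply: le_ereal_inf_tmp => _ [c [c0 dom] <-].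
apply: ge_ereal_sup => _ [B [_ B1] <-].
by rewrite -[c]mulr1; exact: dominated_mb_const.
Qed.

Lemma order_bounded_fin_num T : order_bounded_operators E F T ->
  multi_bounded_norm T \is a fin_num /\ b_norm T \is a fin_num.
Proof.
move=> /order_bounded_dominated[c c0 dom].
have bc : (b_norm T < +oo)%E by apply: le_lt_trans (b_norm_le c0 dom) (ltry _).
rewrite !ge0_fin_numE ?multi_bounded_norm_ge0 ?b_norm_ge0 //.
by rewrite (le_lt_trans (multi_bounded_norm_le_b_norm T)).
Qed.

Lemma mb_const_image_Delta T v m : multi_bounded_norm T = m%:E ->
  0 <= v -> `|v| = 1 -> (mb_const (T @` Delta v) <= m%:E)%E.
Proof.
move=> <- v0 v1; apply: ereal_sup_ubound; exists (Delta v) => //.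
have := mb_const_Delta v0; rewrite v1 => h; split=> //.
by apply: le_lt_trans h (ltry _).
Qed.

(** Common core of the monotonically bounded and the Nakano cases, which differ in how they bound
    finite joins. The error [e] disappears in the infimum defining [b_norm]. *)
Lemma b_norm_le_mul T K : order_bounded_operators E F T -> 0 <= K ->
  (forall v m e, 0 <= v -> 0 <= m -> 0 < e ->
     (mb_const (T @` Delta v) <= m%:E)%E ->
     exists2 w, ubound (finite_joins (T @` Delta v)) w & `|w| <= K * m + e) ->
  (b_norm T <= K%:E * multi_bounded_norm T)%E.
Proof.
move=> Tob K0 HK; have [fm fb] := order_bounded_fin_num Tob.
have eqm := fineK fm; set m := fine _ in eqm.
have m0 : 0 <= m by rewrite -lee_fin eqm multi_bounded_norm_ge0.
rewrite -eqm -EFinM; apply/lee_addgt0Pr => e e0; rewrite -EFinD.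
apply: b_norm_le; first by rewrite addr_ge0 ?mulr_ge0 // ltW.
apply: dominated_unit => [|v v0 v1]; first by rewrite addr_ge0 ?mulr_ge0 // ltW.
have [w /ubound_finite_joins[w0 Tw] wle] :=
  HK v m e v0 m0 e0 (mb_const_image_Delta (esym eqm) v0 v1).
by exists w.
Qed.

End OperatorNorms.

(** * The Riesz-Kantorovich construction *)

Section RieszKantorovich.
Variables (R : realType) (E F : banachLatticeType R).
Implicit Types (u v x y : E) (w : F) (s : seq E).

(** Bundles a linear map given by a formula in the middle of a proof, up to pointwise equality. *)
Lemma linear_pack (f : E -> F) : linear f -> exists g : {linear E -> F}, g =1 f.
Proof.
move=> fl; pose fL := GRing.isLinear.Build R E F _ f fl.
by exists (HB.pack f fL : {linear E -> F}).
Qed.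

Lemma positive_operator_le (A : {linear E -> F}) x y :
  positive_operator A -> x <= y -> A x <= A y.
Proof. by move=> A0; rewrite -bl_subr_ge0 => /A0; rewrite linearB /= bl_subr_ge0. Qed.

(** The extension is [f(x^+) - f(x^-)]. By additivity its value is the same for every way of writing
    [x] as a difference of positive elements ([gE]), and linearity follows. *)
Lemma cone_extension (f : E -> F) :
  (forall x y, 0 <= x -> 0 <= y -> f (x + y) = f x + f y) ->
  (forall (a : R) x, 0 <= a -> 0 <= x -> f (a *: x) = a *: f x) ->
  exists A : {linear E -> F}, forall x, 0 <= x -> A x = f x.
Proof.
move=> fD fZ; pose g x := f (bpos x) - f (bpos (- x)).
have gE x y z : 0 <= y -> 0 <= z -> x = y - z -> g x = f y - f z.
  move=> y0 z0 xyz; have : f (bpos x) + f z = f y + f (bpos (- x)).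
    rewrite -!fD ?bpos_ge0 //; congr f.
    have := bposB x; rewrite [RHS]xyz => e.
    by rewrite -[bpos x](subrK (bpos (- x))) e; linring R.
  move=> e; rewrite /g -[f (bpos x)](addrK (f z)) e; linring R.
have gD x y : g (x + y) = g x + g y.
  rewrite (@gE _ (bpos x + bpos y) (bpos (- x) + bpos (- y))) ?bl_addr_ge0 ?bpos_ge0 //.
    by rewrite !fD ?bpos_ge0 // /g; linring R.
  by rewrite -{1}(bposB x) -{1}(bposB y); linring R.
have gN x : g (- x) = - g x by rewrite /g opprK opprB.
have gZ_ge0 (a : R) x : 0 <= a -> g (a *: x) = a *: g x.
  move=> a0; rewrite (@gE _ (a *: bpos x) (a *: bpos (- x))) ?bl_scaler_ge0 ?bpos_ge0 //.
    by rewrite !fZ ?bpos_ge0 // scalerBr.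
  by rewrite -scalerBr bposB.
have gZ (a : R) x : g (a *: x) = a *: g x.
  have [/gZ_ge0 //|a0] := leP 0 a.
  rewrite -[a]opprK scaleNr gN gZ_ge0 ?scaleNr // oppr_ge0 ltW //.
have [A Ag] : exists A : {linear E -> F}, A =1 g.
  by apply: linear_pack => a x y; rewrite gD gZ.
exists A => x x0; rewrite Ag (@gE x x 0) ?subr0 //.
by rewrite -(scale0r (0 : E)) fZ // scale0r subr0.
Qed.

Definition cone_partition s v : Prop :=
  (forall y, y \in s -> 0 <= y) /\ \sum_(y <- s) y = v.

(** Greedy splitting: the head [y] gives its meet with [u] to [u] and the rest to [v]; the tail is
    then split between what remains of [u] and of [v]. *)
Lemma riesz_decomposition s u v : 0 <= u -> 0 <= v -> cone_partition s (u + v) ->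
  exists t : seq (E * E), [/\ s = [seq p.1 + p.2 | p <- t],
    cone_partition (map fst t) u & cone_partition (map snd t) v].
Proof.
elim: s u v => [|y s IH] u v u0 v0 [s0 suv].
  rewrite big_nil in suv; exists [::]; split=> //.
    split=> //; rewrite big_nil; apply/le_anti; rewrite u0 suv /=.
    by apply: (bl_le_eq v0); linring R.
  split=> //; rewrite big_nil; apply/le_anti; rewrite v0 suv /=.
  by apply: (bl_le_eq u0); linring R.
have y0 : 0 <= y by apply: s0; rewrite mem_head.
have {}s0 z : z \in s -> 0 <= z by move=> zs; apply: s0; rewrite inE zs orbT.
rewrite big_cons in suv.
have sums0 : 0 <= \sum_(z <- s) z by rewrite big_seq; exact: bl_sumr_ge0.
pose y1 := (y `&` u)%O.
have y1u : y1 <= u by exact: leIr.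
have y1y : y1 <= y by exact: leIl.
have y1_0 : 0 <= y1 by rewrite lexI y0.
(* Equivalently [y - v <= y1]; here [y - v <= u] because the entries of the tail are nonnegative. *)
have y2v : y - y1 <= v.
  rewrite bl_lerBlDr addrC -bl_lerBlDr lexI; apply/andP; split.
    by apply: (bl_le_eq v0); linring R.
  rewrite bl_lerBlDr -suv.
  by apply: (bl_le_eq sums0); rewrite addrAC subrr add0r.
have [|||t [ts [t1 t1u] [t2 t2v]]] := IH (u - y1) (v - (y - y1)).
- by rewrite bl_subr_ge0.
- by rewrite bl_subr_ge0.
- split=> //; have -> : \sum_(z <- s) z = u + v - y.
    by rewrite -suv addrAC subrr add0r.
  by linring R.
exists ((y1, y - y1) :: t); split => /=.
- by rewrite -ts; congr cons; linring R.
- split; last by rewrite big_cons t1u; linring R.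
  by move=> z; rewrite inE => /predU1P[->//|/t1].
- split; last by rewrite big_cons t2v; linring R.
  by move=> z; rewrite inE => /predU1P[->|/t2 //]; rewrite bl_subr_ge0.
Qed.

(** [A v] is the supremum of the sums of [G] over partitions of [v]. Concatenating partitions gives
    superadditivity; Riesz decomposition together with subadditivity of [G] gives the converse. *)
Lemma riesz_kantorovich (G : E -> F) : dedekind_complete F ->
  (forall (a : R) x, 0 <= a -> 0 <= x -> G (a *: x) = a *: G x) ->
  (forall x y, 0 <= x -> 0 <= y -> G (x + y) <= G x + G y) ->
  (forall v, 0 <= v -> exists w, forall s, cone_partition s v ->
     \sum_(y <- s) G y <= w) ->
  exists A : {linear E -> F}, forall v, 0 <= v -> G v <= A v /\
    forall w, (forall s, cone_partition s v -> \sum_(y <- s) G y <= w) -> A v <= w.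
Proof.
move=> dcF GZ GD Gb.
pose P v := [set \sum_(y <- s) G y | s in [set s | cone_partition s v]].
have part1 v : 0 <= v -> cone_partition [:: v] v.
  by move=> v0; split=> [y|]; rewrite ?big_seq1 // inE => /eqP ->.
(* The condition [0 <= v] stands under the existential so that [choice] gives a function on all of
   [E]. *)
have sup_ex v : exists w, 0 <= v -> supremums (P v) w.
  have [v0|nv0] := boolP (0 <= v); last by exists 0 => v0; case/negP: nv0.
  have [||w wP] := dcF (P v); last by exists w.
    by exists (\sum_(y <- [:: v]) G y), [:: v] => //; exact: part1.
  by have [w wP] := Gb _ v0; exists w => _ [s sv <-]; exact: wP.
have [f fP] := choice sup_ex.
have f_ub v s : 0 <= v -> cone_partition s v -> \sum_(y <- s) G y <= f v.
  by move=> v0 sv; have [+ _] := fP _ v0; apply; exists s.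
have f_lub v w : 0 <= v -> (forall s, cone_partition s v -> \sum_(y <- s) G y <= w) ->
    f v <= w.
  by move=> v0 sv; have [_] := fP _ v0; apply=> _ [s ? <-]; exact: sv.
have fD x y : 0 <= x -> 0 <= y -> f (x + y) = f x + f y.
  move=> x0 y0; apply/le_anti/andP; split.
    apply: (f_lub); first exact: bl_addr_ge0.
    move=> s /(riesz_decomposition x0 y0)[t [-> tx ty]].
    apply: le_trans (bl_lerD (f_ub _ _ x0 tx) (f_ub _ _ y0 ty)).
    case: tx ty => t1 _ [t2 _]; rewrite !big_map -big_split /= !big_seq.
    elim/big_ind2: _ => // [*|p pt]; first exact: bl_lerD.
    by apply: GD; [apply: t1|apply: t2]; apply: map_f.
  rewrite -bl_lerBrDr; apply: (f_lub) => // s [s0 ss].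
  rewrite bl_lerBrDr addrC -bl_lerBrDr; apply: (f_lub) => // t [t0 ts].
  rewrite bl_lerBrDr addrC -big_cat; apply: (f_ub); first exact: bl_addr_ge0.
  by split=> [z|]; rewrite ?big_cat ?ss ?ts // mem_cat => /orP[/s0|/t0].
have fZ_le (a : R) x : 0 < a -> 0 <= x -> a *: f x <= f (a *: x).
  move=> a0 x0; rewrite -[leRHS](scalerKV (lt0r_neq0 a0)) bl_ler_pZ2l //.
  apply: (f_lub) => // s [s0 ss].
  rewrite -(@bl_ler_pZ2l _ _ a) // scalerKV ?gt_eqF // scaler_sumr big_seq.
  rewrite (eq_bigr (fun y => G (a *: y))) => [|y ys]; last by rewrite GZ ?(ltW a0) ?s0.
  rewrite -big_seq -(big_map (fun y => a *: y) xpredT G); apply: (f_ub).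
    by rewrite bl_scaler_ge0 // ltW.
  split; last by rewrite big_map -scaler_sumr ss.
  by move=> _ /mapP[y ys ->]; rewrite bl_scaler_ge0 ?s0 // ltW.
have fZ (a : R) x : 0 <= a -> 0 <= x -> f (a *: x) = a *: f x.
  rewrite le_eqVlt => /predU1P[<- x0|a0 x0].
    by rewrite !scale0r; apply: (addIr (f 0)); rewrite -fD // !add0r.
  apply/le_anti; rewrite fZ_le // andbT.
  rewrite -(@bl_ler_pZ2l _ _ a^-1) ?invr_gt0 // scalerK ?gt_eqF //.
  rewrite -{2}[x](scalerK (lt0r_neq0 a0)) fZ_le ?invr_gt0 //.
  by rewrite bl_scaler_ge0 // ltW.
have [A Af] := cone_extension fD fZ; exists A => v v0; rewrite Af //; split.
  by have := f_ub _ _ v0 (part1 _ v0); rewrite big_seq1.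
by move=> w; exact: f_lub.
Qed.

(** [N] is the modulus of the real operator [S]. Its minimality carries a scalar [c >= 0] so that it
    applies directly to bounds such as [b N <= A - a S]. *)
Lemma operator_abs (S A : {linear E -> F}) : dedekind_complete F ->
  (forall v, 0 <= v -> babs (S v) <= A v) ->
  exists N : {linear E -> F}, (forall v, 0 <= v -> babs (S v) <= N v) /\
    forall (c : R) (B : {linear E -> F}), 0 <= c ->
      (forall v, 0 <= v -> babs (c *: S v) <= B v) ->
      forall v, 0 <= v -> c *: N v <= B v.
Proof.
move=> dcF SA.
have sum_le s v (B : {linear E -> F}) : (forall v, 0 <= v -> babs (S v) <= B v) ->
    cone_partition s v -> \sum_(y <- s) babs (S y) <= B v.
  move=> SB [s0 <-]; rewrite linear_sum /= !big_seq.
  elim/big_ind2: _ => // [*|y /s0/SB //]; exact: bl_lerD.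
have [||v v0|N NP] := @riesz_kantorovich (fun v => babs (S v)) dcF.
- by move=> a x a0 _; rewrite linearZ /= babsZ.
- by move=> x y _ _; rewrite linearD /= babsD.
- by exists (A v) => s; exact: sum_le.
exists N; split=> [v v0|c B c0 SB v v0]; first by have [] := NP _ v0.
move: c0; rewrite le_eqVlt => /predU1P[c0|c0].
  by rewrite -c0 scale0r; apply: le_trans (babs_ge0 _) (SB _ v0).
rewrite -(@bl_ler_pZ2l _ _ c^-1) ?invr_gt0 // scalerK ?gt_eqF //.
have [_] := NP _ v0; apply => s sv.
have [B' B'E] : exists B' : {linear E -> F}, B' =1 fun x => c^-1 *: B x.
  by apply: linear_pack => a x y; rewrite linearP /=; linring R.
rewrite -B'E; apply: sum_le sv => x x0.
by rewrite B'E -(@bl_ler_pZ2l _ _ c) // scalerKV ?gt_eqF // -babsZ ?SB // ltW.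
Qed.

End RieszKantorovich.

(** * The modulus of an order-bounded operator *)

Section HalfAngle.
Variable R : realType.
Implicit Types c s : R.

(** The new pair consists of the cosine and sine of half the angle; the last bound is
    [1 - c <= 1 - c^2], valid for [0 <= c <= 1]. *)
Lemma half_angle (c s : R) : circle c s -> 0 <= c -> 0 < s -> exists c' s' : R,
  [/\ circle c' s', 0 <= c', 0 < s', c = c' ^+ 2 - s' ^+ 2 & s = 2 * (c' * s')]
  /\ 2 * s' ^+ 2 <= s ^+ 2.
Proof.
rewrite /circle => cs c0 s0.
have c1 : c < 1 by nra.
have cp : 0 <= (1 + c) / 2 by lra.
have sp : 0 < (1 - c) / 2 by lra.
exists (Num.sqrt ((1 + c) / 2)), (Num.sqrt ((1 - c) / 2)).
rewrite /circle !sqr_sqrtr ?(ltW sp) // sqrtr_ge0 sqrtr_gt0 sp.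
split; last by nra.
split=> //; try lra.
rewrite -sqrtrM // -[LHS]ger0_norm ?(ltW s0) // -sqrtr_sqr.
have -> : s ^+ 2 = 2 ^+ 2 * ((1 + c) / 2 * ((1 - c) / 2)).
  by rewrite -[s ^+ 2](addKr (c ^+ 2)) cs; field.
by rewrite [LHS]sqrtrM ?sqr_ge0 // sqrtr_sqr ger0_norm.
Qed.

End HalfAngle.

Section Folding.
Variables (R : realType) (E F : banachLatticeType R).
Implicit Types (S U A : {linear E -> F}) (x y m : E).

(** For [b >= 0], [b *: babs y] is the join of [b *: y] and its opposite, and both [(a, b)] and
    [(a, - b)] lie on the circle; for [b < 0] it lies below [b *: y]. *)
Lemma circle_ub_fold (V : banachLatticeType R) (x y m : V) :
  circle_ub x y m -> circle_ub x (babs y) m.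
Proof.
move=> xym a b ab; have [b0|b0] := leP 0 b; last first.
  apply: le_trans (xym a b ab); rewrite bl_lerD // -bl_lerN2 -!scaleNr.
  by rewrite bl_ler_wpZ2l ?ler_babs // oppr_ge0 ltW.
rewrite addrC -bl_lerBrDr -babsZ // babs_le !bl_lerBrDr ![_ + a *: x]addrC.
by rewrite xym //= -scaleNr xym // /circle sqrrN.
Qed.

Lemma circle_ub_rot (V : banachLatticeType R) (x y m : V) c s :
  circle c s -> circle_ub x y m ->
  circle_ub (c *: x + s *: y) (- s *: x + c *: y) m.
Proof.
move=> cs xym a b ab.
have cs' : circle c (- s) by rewrite /circle sqrrN.
have := xym _ _ (_ : circle (a * c + b * - s) (- (a * - s - b * c))).
have -> : (a * c + b * - s) *: x + - (a * - s - b * c) *: y =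
    a *: (c *: x + s *: y) + b *: (- s *: x + c *: y) by linring R.
by apply; have := circle_rot cs' ab; rewrite /circle sqrrN.
Qed.

(* [(S, U)] and [(x, y)] both lie in the sector [|angle| <= atan (s / c)]. *)
Definition in_sector c s (S U : E -> F) x y : Prop :=
  (babs (c *: y) <= s *: x) /\ forall v, 0 <= v -> babs (c *: U v) <= s *: S v.

Definition dominated_pair (S U A : E -> F) : Prop :=
  forall v, 0 <= v -> circle_ub (S v) (U v) (A v).

(* Reflecting both pairs into the half-plane [0 <= angle] preserves their moduli
   and increases the pairing [S x + U y]; a rotation preserves it. *)
Lemma fold_step S U A x y m c s : dedekind_complete F -> circle c s ->
  0 <= c -> 0 <= s -> dominated_pair S U A -> circle_ub x y m ->
  exists S' U' : {linear E -> F}, exists x' y' : E,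
  [/\ dominated_pair S' U' A, circle_ub x' y' m,
      S x + U y <= S' x' + U' y'
    & (c = 0 /\ s = 1 \/ (0 <= c ^+ 2 - s ^+ 2) /\
         in_sector (c ^+ 2 - s ^+ 2) (2 * (c * s)) S U x y) ->
      in_sector c s S' U' x' y'].
Proof.
move=> dcF cs c0 s0 SUA xym.
have UA v : 0 <= v -> babs (U v) <= A v by move=> /SUA /circle_ub_babs[].
have [N [UN Nlub]] := operator_abs dcF UA.
have N0 v : 0 <= v -> 0 <= N v.
  by move=> v0; apply: le_trans (UN v v0); exact: babs_ge0.
(* For [b >= 0] the claim is [b N <= A - a S], which follows from the minimality of [N] since
   [A - a S] dominates both [b U] and [- b U]. *)
have SNA : dominated_pair S N A.
  move=> v v0 a b ab; have [b0|b0] := leP 0 b; last first.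
    apply: le_trans (SUA v v0 a b ab); rewrite bl_lerD // -bl_lerN2 -!scaleNr.
    rewrite bl_ler_wpZ2l ?oppr_ge0 ?(ltW b0) //.
    by apply: le_trans (UN v v0); exact: ler_babs.
  have [B BE] : exists B : {linear E -> F}, B =1 fun v => A v - a *: S v.
    by apply: linear_pack => k u w; rewrite !linearP /=; linring R.
  rewrite addrC -bl_lerBrDr -BE; apply: Nlub => // u u0; rewrite BE.
  rewrite babs_le !bl_lerBrDr ![_ + a *: _]addrC (SUA u u0) //=.
  by rewrite -scaleNr (SUA u u0) // /circle sqrrN.
have [S' S'E] : exists B : {linear E -> F}, B =1 fun v => c *: S v + s *: N v.
  by apply: linear_pack => k u w; rewrite !linearP /=; linring R.
have [U' U'E] : exists B : {linear E -> F}, B =1 fun v => - s *: S v + c *: N v.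
  by apply: linear_pack => k u w; rewrite !linearP /=; linring R.
exists S', U', (c *: x + s *: babs y), (- s *: x + c *: babs y); split.
- by move=> v v0; rewrite S'E U'E; apply: circle_ub_rot => //; exact: SNA.
- by apply: circle_ub_rot => //; exact: circle_ub_fold.
- rewrite S'E U'E !linearD !linearZ /=.
  have Uy : U y <= N (babs y).
    rewrite -{1}(bposB y) linearB babsE linearD /=.
    apply: bl_lerD; first by apply: le_trans (UN _ (bpos_ge0 _)); exact: ler_babs.
    by apply: le_trans (UN _ (bpos_ge0 _)); exact: lerN_babs.
  rewrite -bl_subr_ge0 in Uy; apply: (bl_le_eq Uy); move: cs; rewrite /circle => cs.
  linring R; ring: cs.
- move=> H.
  (* Let [c = cos t] and [s = sin t]. Folding takes the sector [[-2t, 2t]] to [[0, 2t]], and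
     rotation by [-t] then gives [[-t, t]]; [(p, n)] is the folded pair. *)
  have sec (V : banachLatticeType R) (p n : V) : 0 <= n ->
      (c ^+ 2 - s ^+ 2) *: n <= (2 * (c * s)) *: p ->
      babs (c *: (- s *: p + c *: n)) <= s *: (c *: p + s *: n).
    move=> n0; rewrite -bl_subr_ge0 => h; rewrite babs_le; apply/andP; split.
      by apply: (bl_le_eq h); linring R.
    by apply: (bl_le_eq n0); move: cs; rewrite /circle => cs; linring R; ring: cs.
  have [[c_0 s_1]|[C0 [xy SU]]] := H.
    (* In the first fold no sector is given beforehand, and the condition of [sec] reduces to
       [- n <= 0]. *)
    split=> [|v v0]; rewrite ?S'E ?U'E; apply: sec; rewrite ?babs_ge0 ?N0 //.
      rewrite c_0 s_1 mul0r mulr0 scale0r expr0n expr1n sub0r scaleN1r.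
      by rewrite -(oppr0 E) bl_lerN2 babs_ge0.
    rewrite c_0 s_1 mul0r mulr0 scale0r expr0n expr1n sub0r scaleN1r.
    by rewrite -(oppr0 F) bl_lerN2 N0.
  split=> [|v v0]; rewrite ?S'E ?U'E; apply: sec; rewrite ?babs_ge0 ?N0 //.
    by rewrite -babsZ.
  have [B BE] : exists B : {linear E -> F}, B =1 fun v => (2 * (c * s)) *: S v.
    by apply: linear_pack => k u w; rewrite !linearP /=; linring R.
  by rewrite -BE; apply: Nlub => // u u0; rewrite BE SU.
Qed.

(** The first fold has [c = 0] and [s = 1]; each further one halves the angle, which at least halves
    [s ^+ 2]. *)
Lemma fold_iter S U A x y m n : dedekind_complete F ->
  dominated_pair S U A -> circle_ub x y m ->
  exists S' U' : {linear E -> F}, exists x' y' : E, exists c s : R,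
  [/\ dominated_pair S' U' A, circle_ub x' y' m,
      S x + U y <= S' x' + U' y', in_sector c s S' U' x' y'
    & [/\ circle c s, 0 <= c, 0 < s & 2 ^+ n * s ^+ 2 <= 1]].
Proof.
move=> dcF SUA xym; elim: n => [|n].
  have c01 : circle (0 : R) 1 by rewrite /circle expr1n expr0n add0r.
  have [S' [U' [x' [y' [h1 h2 h3 h4]]]]] :=
    fold_step dcF c01 (lexx 0) ler01 SUA xym.
  exists S', U', x', y', 0, 1; split=> //; first by apply: h4; left.
  by split; rewrite ?expr0 ?expr1n ?mul1r.
move=> [S1 [U1 [x1 [y1 [c [s [SU1 xy1 le1 sec1 [cs c0 s0 sn]]]]]]]].
have [c' [s' [[cs' c'0 s'0 cE sE] s's]]] := half_angle cs c0 s0.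
have [S' [U' [x' [y' [h1 h2 h3 h4]]]]] := fold_step dcF cs' c'0 (ltW s'0) SU1 xy1.
exists S', U', x', y', c', s'; split=> //; first exact: le_trans le1 h3.
  by apply: h4; right; rewrite -cE -sE.
split=> //; apply: le_trans sn; rewrite exprSr -mulrA ler_pM2l ?expr2_gt0 //.
Qed.

(** In a narrow sector [c U' y' <= s S' |y'|] and [c S' |y'| <= s S' x'], whence
    [c^2 (S' x' + U' y') <= S' x' <= A m]. Thus [q] is at most [A m + s^2 |q|] with [s] arbitrarily
    small, and the Archimedean property concludes. *)
Lemma pairing_le_modulus S U A x y m : dedekind_complete F ->
  dominated_pair S U A -> circle_ub x y m -> S x + U y <= A m.
Proof.
move=> dcF SUA xym; set q := S x + U y.
have A0 : positive_operator A.
  by move=> v /SUA /circle_ub_babs[+ _]; apply: le_trans; exact: babs_ge0.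
apply: (@bl_archimedean _ _ _ _ (babs q)) => e e0.
have [n ne] : exists n, (2 ^+ n)^-1 <= e.
  apply: contrapT => non; apply: (@natr_unbounded R e^-1) => n.
  apply: (@le_trans _ _ (2 ^+ n)); first by rewrite -natrX ler_nat ltnW // ltn_expl.
  rewrite -[leLHS]invrK lef_pV2 ?posrE ?invr_gt0 ?expr2_gt0 //.
  by rewrite leNgt; apply/negP => /ltW en; apply: non; exists n.
have [S' [U' [x' [y' [c [s [SU' xy' qle [xys SUs] [cs c0 s0 sn]]]]]]]] :=
  fold_iter n dcF SUA xym.
have se : s ^+ 2 <= e.
  by apply: le_trans ne; rewrite -[leRHS]mul1r ler_pdivlMr ?expr2_gt0 // mulrC.
have x'0 : 0 <= x'.
  by rewrite -(@bl_ler_pZ2l _ _ s) // scaler0 (le_trans (babs_ge0 _) xys).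
have S'0 : positive_operator S'.
  move=> v v0; rewrite -(@bl_ler_pZ2l _ _ s) // scaler0.
  exact: le_trans (babs_ge0 _) (SUs v v0).
have S'x' : S' x' <= A m.
  have [+ _] := circle_ub_babs xy'; rewrite babs_le => /andP[x'm _].
  have [+ _] := circle_ub_babs (SU' _ x'0); rewrite babs_le => /andP[SAx _].
  exact: le_trans SAx (positive_operator_le A0 x'm).
have cU : c *: U' y' <= s *: S' (babs y').
  rewrite -{1}(bposB y') [U' _]linearB babsE [S' _]linearD /= scalerBr scalerDr.
  have := SUs _ (bpos_ge0 y'); have := SUs _ (bpos_ge0 (- y')).
  by rewrite !babs_le => /andP[_ h1] /andP[h2 _]; exact: bl_lerD.
have cS : c *: S' (babs y') <= s *: S' x'.
  by rewrite -!linearZ /= -babsZ //; exact: positive_operator_le.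
have c2 : c ^+ 2 *: (S' x' + U' y') <= A m.
  apply: le_trans S'x'.
  have := bl_lerD (bl_ler_wpZ2l c0 cU) (bl_ler_wpZ2l (ltW s0) cS).
  rewrite -bl_subr_ge0 => h; apply: (bl_le_eq h).
  by move: cs; rewrite /circle => cs; linring R; ring: cs.
have := le_trans (bl_ler_wpZ2l (sqr_ge0 c) qle) c2; rewrite -/q => cq.
apply: le_trans (_ : _ <= A m + s ^+ 2 *: babs q) _; last first.
  by rewrite bl_lerD // bl_ler_wpZ2r ?babs_ge0.
have := bl_lerD cq (bl_ler_wpZ2l (sqr_ge0 s) (ler_babs q)).
by rewrite -scalerDl cs scale1r.
Qed.

End Folding.

Section OperatorModulus.
Variables (R : realType) (E F : banachLatticeType R).
Implicit Types (T : {linear cplx E -> cplx F}) (A : {linear E -> F}).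

(** [S] and [U] are the real and imaginary parts of [T] on real elements; complex linearity recovers
    [T] from them. *)
Lemma cplx_operator_parts T : exists S U : {linear E -> F},
  [/\ forall z, T z = (S z.1 - U z.2, S z.2 + U z.1)
    & forall z, T z = cplx_map S z + (Complex 0 1 : R[i]) *: cplx_map U z].
Proof.
have TP (k : R) x y : T (real_cplx (k *: x + y)) =
    (k%:C)%C *: T (real_cplx x) + T (real_cplx y).
  rewrite -linearP; congr (T _); rewrite cplx_scale_real /real_cplx /=.
  by congr (_, _); rewrite scaler0 addr0.
have [S SE] : exists S : {linear E -> F}, S =1 fun x => (T (real_cplx x)).1.
  by apply: linear_pack => k x y; rewrite TP cplx_scale_real.
have [U UE] : exists U : {linear E -> F}, U =1 fun x => (T (real_cplx x)).2.
  by apply: linear_pack => k x y; rewrite TP cplx_scale_real.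
have Tz z : T z = (S z.1 - U z.2, S z.2 + U z.1).
  have zE : z = real_cplx z.1 + (Complex 0 1 : R[i]) *: real_cplx z.2.
    rewrite cplx_scaleE /real_cplx /=.
    case: z => x y; congr (_, _);
      by rewrite /= !(scale0r, scaler0, scale1r, subr0, addr0, add0r).
  rewrite {1}zE linearD linearZ /= !SE !UE.
  rewrite cplx_scaleE /=.
  by congr (_, _); rewrite /= !scale0r !scale1r ?add0r ?addr0 ?sub0r //= addrC.
exists S, U; split=> // z; rewrite Tz /cplx_map cplx_scaleE /=.
by congr (_, _); rewrite /= !scale0r !scale1r ?add0r ?addr0 ?sub0r.
Qed.

(* Choosing phases [theta_j] that make [Re (exp (i theta_j) T y_j)] close to
   [|T y_j|], the element [sum_j exp (i theta_j) y_j] has modulus at most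
   [sum_j y_j]; the induction chooses the phases one at a time. *)
Lemma sum_cmod_le T s w : (forall y, y \in s -> 0 <= y) ->
  (forall z, cmod z <= \sum_(y <- s) y -> (T z).1 <= w) ->
  \sum_(y <- s) cmod (T (real_cplx y)) <= w.
Proof.
elim: s w => [|y s IH] w s0 Tw.
  by have := Tw 0; rewrite !big_nil linear0 cmod0; apply.
rewrite big_cons -bl_lerBrDr; apply/cmod_le => a b ab.
rewrite bl_lerBrDr addrC -bl_lerBrDr; apply: IH => [x xs|z zs].
  by apply: s0; rewrite inE xs orbT.
have y0 : 0 <= y by apply: s0; rewrite mem_head.
(* The phase [a - ib] turns the real part of the image of [y] into [a] times its real part plus [b]
   times its imaginary part. *)
have cy : cmod ((Complex a (- b) : R[i]) *: real_cplx y : cplx E) <= y.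
  apply/cmod_le => p q pq; rewrite cplx_scaleE /= !scaler0 subr0 add0r.
  rewrite !scalerA -scalerDl -[leRHS]scale1r bl_ler_wpZ2r //.
  have ab' : circle a (- b) by rewrite /circle sqrrN.
  by have /andP[] := circle_bound (circle_rot ab' pq).
have := Tw (z + (Complex a (- b) : R[i]) *: real_cplx y).
rewrite linearD linearZ /= big_cons => h.
rewrite bl_lerBrDr; apply: le_trans (h _); last first.
  by rewrite addrC; apply: le_trans (cmodD _ _) _; rewrite bl_lerD.
by rewrite scaleNr opprK.
Qed.

(** The bound on partition sums and the minimality of [A] both come from [sum_cmod_le]; the middle
    clause is the bilinear inequality. *)
Lemma operator_modulus T : dedekind_complete F -> order_bounded_operators E F T ->
  exists A : {linear E -> F}, [/\ positive_operator A,
    forall z, cmod (T z) <= A (cmod z)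
  & forall v w, 0 <= v -> T @` Delta v `<=` Delta w -> A v <= w].
Proof.
move=> dcF Tob.
have sum_le v w s : T @` Delta v `<=` Delta w -> cone_partition s v ->
    \sum_(y <- s) cmod (T (real_cplx y)) <= w.
  move=> Tvw [s0 sv]; apply: sum_cmod_le => // z; rewrite sv => zv.
  by apply: le_trans (re_le_cmod _) (Tvw _ _); exists z.
have [||v v0|A AP] := @riesz_kantorovich _ _ _ (fun v => cmod (T (real_cplx v))) dcF.
- move=> a x a0 _; rewrite -cmodZ // -cplx_scale_real -linearZ /=.
  by congr (cmod (T _)); rewrite cplx_scale_real /real_cplx /= scaler0.
- move=> x y _ _; apply: le_trans (cmodD _ _); rewrite -linearD.
  suff -> : real_cplx (x + y) = real_cplx x + real_cplx y by [].
  by rewrite /real_cplx -[RHS]/(x + y, 0 + 0) addr0.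
- have [w [_ Tw]] : order_bounded (T @` Delta v) by apply: Tob; exists v; split.
  by exists w => s; exact: sum_le.
have [S [U [TE _]]] := cplx_operator_parts T.
have SUA : dominated_pair S U A.
  move=> v v0 a b ab; have [+ _] := AP v v0; apply: le_trans.
  apply: le_trans (cmod_ub (T (real_cplx v)) ab).
  by rewrite TE /= [U 0]linear0 [S 0]linear0 subr0 add0r.
exists A; split.
- by move=> v v0; have [+ _] := AP v v0; apply: le_trans; exact: cmod_ge0.
- move=> z; apply/cmod_le => a b ab; rewrite TE /=.
  (* This is the pairing of [(S, U)] with the product of [a + ib] and the conjugate of [z], a pair
     bounded by the modulus of [z]. *)
  have -> : a *: (S z.1 - U z.2) + b *: (S z.2 + U z.1) =
      S (a *: z.1 + b *: z.2) + U (b *: z.1 - a *: z.2).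
    rewrite [S (_ + _)]linearP [U (_ - _)]linearB /= [S (b *: _)]linearZ.
    by rewrite [U (b *: _)]linearZ [U (a *: _)]linearZ /=; linring R.
  apply: pairing_le_modulus => // p q pq.
  have -> : p *: (a *: z.1 + b *: z.2) + q *: (b *: z.1 - a *: z.2) =
      (p * a + q * b) *: z.1 + (p * b - q * a) *: z.2 by linring R.
  by apply: cmod_ub; exact: circle_rot.
- by move=> v w v0 Tvw; have [_] := AP v v0; apply => s; exact: sum_le.
Qed.

Lemma cmod_cplx_map A z : positive_operator A -> cmod (cplx_map A z) <= A (cmod z).
Proof.
move=> A0; apply/cmod_le => a b ab /=; rewrite -!linearZ -linearD /=.
by apply: positive_operator_le => //; exact: cmod_ub.
Qed.

Lemma opnorm_ge0 (f : cplx E -> cplx F) : (0 <= opnorm f)%E.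
Proof.
apply: le_trans (_ : _ <= (cnorm (f 0))%:E)%E _; first by rewrite lee_fin normr_ge0.
by apply: ereal_sup_ubound; exists 0 => //=; rewrite /cnorm cmod0 normr0.
Qed.

Lemma b_norm_le_r_norm T : (b_norm T <= r_norm T)%E.
Proof.
apply: le_ereal_inf_tmp => _ [S [S0 TS] <-].
have := opnorm_ge0 (cplx_map S).
case eqS: (opnorm _) => [r||] // r0; last by rewrite leey.
rewrite lee_fin in r0; apply: b_norm_le => //; apply: dominated_unit => // v v0 v1.
exists (S v); split; first exact: S0.
  move=> _ [z zv <-]; apply: le_trans (TS z) _; exact: positive_operator_le.
rewrite -lee_fin -eqS; apply: ereal_sup_ubound; exists (real_cplx v).
  by rewrite /= /cnorm cmod_real norm_babs v1.
by rewrite /cnorm /cplx_map /= linear0 cmod_real norm_babs.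
Qed.

(** The modulus [A] of [T] is a competitor in [r_norm], and by its minimality each constant
    admissible for [b_norm] bounds its norm. *)
Lemma r_norm_eq_b_norm T : dedekind_complete F -> order_bounded_operators E F T ->
  r_norm T = b_norm T.
Proof.
move=> dcF Tob; apply/le_anti; rewrite b_norm_le_r_norm andbT.
have [A [A0 TA Amin]] := operator_modulus dcF Tob.
apply: le_ereal_inf_tmp => _ [c [c0 dom] <-].
apply: (@le_trans _ _ (opnorm (cplx_map A))).
  by apply: ereal_inf_lbound; exists A.
apply: ge_ereal_sup => _ [z /= z1 <-]; rewrite lee_fin.
have [w [w0 Tw wle]] := dom _ (cmod_ge0 z).
apply: (@le_trans _ _ `|w|); last first.
  by apply: le_trans wle _; rewrite -[leRHS]mulr1 ler_wpM2l.
apply: bl_norm_le0; first exact: cmod_ge0.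
apply: le_trans (cmod_cplx_map _ A0) _.
by apply: Amin Tw; exact: cmod_ge0.
Qed.

Lemma regular_order_bounded T :
  regular_operators E F T -> order_bounded_operators E F T.
Proof.
move=> [S [U [[S1 [S2 [S10 S20 SE]]] [U1 [U2 [U10 U20 UE]]] TE]]].
move=> B [v [v0 Bv]].
have bound (P P1 P2 : {linear E -> F}) x : positive_operator P1 -> positive_operator P2 ->
    (forall x, P x = P1 x - P2 x) -> babs x <= v -> babs (P x) <= P1 v + P2 v.
  move=> P10 P20 PE; rewrite babs_le => /andP[xv xNv]; rewrite PE babs_le opprB addrC.
  rewrite -!linearN [P1 v + _]addrC [_ + P1 x]addrC [P2 x + _]addrC.
  rewrite ![P2 v + _]addrC.
  by rewrite !bl_lerD //; apply: positive_operator_le.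
set w := (S1 v + S2 v) + (U1 v + U2 v).
have w0 : 0 <= w.
  by rewrite !bl_addr_ge0 //; [exact: S10|exact: S20|exact: U10|exact: U20].
(* One [w] for the real part of [T z] and one for its imaginary part. *)
exists (w + w); split; first exact: bl_addr_ge0.
move=> _ [z Bz <-]; have [xz yz] := circle_ub_babs (@cmod_ub _ _ z).
have xv := le_trans xz (Bv _ Bz); have yv := le_trans yz (Bv _ Bz).
have w_bound x y : babs x <= v -> babs y <= v -> babs (S x) + babs (U y) <= w.
  by move=> xv' yv'; rewrite bl_lerD ?(bound S S1 S2) ?(bound U U1 U2).
have Tz1 : babs (T z).1 <= w.
  apply: le_trans (w_bound _ _ xv yv).
  rewrite TE cplx_scaleE /= !scale0r scale1r sub0r.
  apply: le_trans (babsD _ _) _; rewrite bl_lerD //.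
  by rewrite /babs opprK joinC.
have Tz2 : babs (T z).2 <= w.
  apply: le_trans (w_bound _ _ yv xv).
  rewrite TE cplx_scaleE /= !scale0r scale1r add0r.
  exact: babsD.
apply/cmod_le => a b ab; apply: bl_lerD.
  apply: le_trans (bl_lerZ_babs _ _) _; apply: le_trans Tz1.
  rewrite -[leRHS]scale1r bl_ler_wpZ2r ?babs_ge0 // ler_norml.
  exact: circle_bound ab.
apply: le_trans (bl_lerZ_babs _ _) _; apply: le_trans Tz2.
rewrite -[leRHS]scale1r bl_ler_wpZ2r ?babs_ge0 // ler_norml.
by apply: (@circle_bound _ _ a); rewrite /circle addrC.
Qed.

Lemma order_bounded_regular T : dedekind_complete F ->
  order_bounded_operators E F T -> regular_operators E F T.
Proof.
move=> dcF Tob; have [A [A0 TA _]] := operator_modulus dcF Tob.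
have [S [U [TE TE']]] := cplx_operator_parts T.
(* A real operator [P] below the positive operator [A] is [A - (A - P)]. *)
have reg (P : {linear E -> F}) : (forall v, 0 <= v -> P v <= A v) -> real_regular P.
  move=> PA; have [B BE] : exists B : {linear E -> F}, B =1 fun x => A x - P x.
    by apply: linear_pack => k x y; rewrite !linearP /=; linring R.
  exists A, B; split=> // x; first by move=> /PA; rewrite BE bl_subr_ge0.
  by rewrite BE; linring R.
have le v : 0 <= v -> babs (S v) <= A v /\ babs (U v) <= A v.
  move=> v0; have := TA (real_cplx v); rewrite cmod_real ger0_babs // => h.
  have [] := circle_ub_babs (@cmod_ub _ _ (T (real_cplx v))).
  move: h; set m := cmod _ => h.
  rewrite TE /= [U 0]linear0 [S 0]linear0 subr0 add0r => h1 h2.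
  by split; [exact: le_trans h1 h|exact: le_trans h2 h].
by exists S, U; split=> //; apply: reg => v /le[] h1 h2;
  [apply: le_trans h1|apply: le_trans h2]; exact: ler_babs.
Qed.

End OperatorModulus.

(** * Comparison of the multi-bounded, order-bounded and regular norms *)

Section Comparison.
Variables (R : realType) (E F : banachLatticeType R).
Implicit Types (T : {linear cplx E -> cplx F}).

Lemma monotonically_bounded_finite_joins : monotonically_bounded F ->
  exists2 M : R, 0 < M & forall (B : set (cplx F)) (m e : R), 0 <= m -> 0 < e ->
    (mb_const B <= m%:E)%E ->
    exists2 w, ubound (finite_joins B) w & `|w| <= M * m + e.
Proof.
move=> /monotonically_bounded_const[M M0 MP]; exists M => // B m e m0 e0 Bm.
(* The slack [e / M] makes the scaling factor positive even for [m = 0], and costs exactly [e] after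
   multiplication by [M]. *)
pose k := m + e / M; have k0 : 0 < k by rewrite ltr_wpDl // divr_gt0.
have kV0 : 0 <= k^-1 by rewrite invr_ge0 ltW.
have [dir0 dir] := finite_joins_directed B.
have [||u uub uM] := MP [set k^-1 *: x | x in finite_joins B].
- split; first by have [x xB] := dir0; exists (k^-1 *: x), x.
  move=> _ _ [x xB <-] [y yB <-]; have [z [zB xz yz]] := dir _ _ xB yB.
  by exists (k^-1 *: z); split; [exists z|exact: bl_ler_wpZ2l|exact: bl_ler_wpZ2l].
- move=> _ [x xB <-]; split; first by rewrite bl_scaler_ge0 // (finite_joins_ge0 xB).
  rewrite normrZ ger0_norm // mulrC ler_pdivrMr // mul1r.
  apply: le_trans (finite_joins_norm m0 Bm xB) _.
  by rewrite lerDl divr_ge0 // ltW.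
exists (k *: u).
  move=> x xB; rewrite -(@bl_ler_pZ2l _ _ k^-1) ?invr_gt0 // scalerK ?gt_eqF //.
  by apply: uub; exists x.
rewrite normrZ gtr0_norm //; apply: (@le_trans _ _ (k * M)).
  by rewrite ler_pM2l.
by rewrite /k mulrDl mulrC divfK ?gt_eqF.
Qed.

Lemma b_norm_le_monotonically_bounded : monotonically_bounded F ->
  exists2 M : R, 0 < M & forall T, order_bounded_operators E F T ->
    (b_norm T <= M%:E * multi_bounded_norm T)%E.
Proof.
move=> /monotonically_bounded_finite_joins[M M0 MP]; exists M => // T Tob.
apply: b_norm_le_mul => //; first exact: ltW.
by move=> v m e _; exact: MP.
Qed.

Lemma b_norm_le_nakano T K : nakano_const F K -> 0 <= K ->
  order_bounded_operators E F T -> (b_norm T <= K%:E * multi_bounded_norm T)%E.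
Proof.
move=> nakF K0 Tob; apply: b_norm_le_mul => // v m e v0 m0 e0 Tm.
(* [nakano_const] concerns order-bounded nets; order-boundedness of [T] supplies the bound [w] for
   the finite joins. *)
have [w [w0 Tw]] : order_bounded (T @` Delta v) by apply: Tob; exists v; split.
apply: (nakano_directed (w := w) nakF K0 (finite_joins_directed _)) => // x xT.
  by rewrite (finite_joins_ge0 xT) (finite_joins_norm m0 Tm xT).
by have /ubound_finite_joins := conj w0 Tw; apply.
Qed.

Lemma multi_bounded_order_bounded T : monotonically_bounded F ->
  multi_bounded_operators E F T -> order_bounded_operators E F T.
Proof.
move=> /monotonically_bounded_finite_joins[M _ MP] Tmb B Bob.
have TB : (mb_const (T @` B) < +oo)%E by apply: Tmb; exact: order_bounded_multi_bounded.
have [m m0 Tm] : exists2 m, 0 <= m & (mb_const (T @` B) <= m%:E)%E.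
  move: TB; case: (mb_const _) => [r||] // _; last by exists 0; rewrite ?leNye.
  by exists `|r|; rewrite ?lee_fin ?ler_norm.
have [w /ubound_finite_joins[w0 Tw] _] := MP _ _ _ m0 ltr01 Tm.
by exists w.
Qed.

Lemma order_bounded_eq_multi_bounded : monotonically_bounded F ->
  order_bounded_operators E F = multi_bounded_operators E F.
Proof.
move=> mbF; apply/seteqP; split=> T; last exact: multi_bounded_order_bounded.
by move=> /order_bounded_dominated[c c0 dom]; exact: dominated_multi_bounded dom.
Qed.

Lemma equivalent_mb_b_norm (K : R) : 0 < K ->
  (forall T, order_bounded_operators E F T ->
     (b_norm T <= K%:E * multi_bounded_norm T)%E) ->
  equivalent_norms_on (order_bounded_operators E F) multi_bounded_norm b_norm.
Proof.
move=> K0 le; exists 1, K; split=> // T Tob.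
have [fm fb] := order_bounded_fin_num Tob.
by split=> //; [rewrite mul1e multi_bounded_norm_le_b_norm|exact: le].
Qed.

Lemma nakano_mb_norm_eq T : nakano F -> order_bounded_operators E F T ->
  multi_bounded_norm T = b_norm T.
Proof.
move=> nakF Tob; apply/le_anti; rewrite multi_bounded_norm_le_b_norm /=.
by have := b_norm_le_nakano nakF ler01 Tob; rewrite mul1e.
Qed.

End Comparison.

Theorem theorem6p33 (R : realType) (E F : banachLatticeType R) :
  [/\ (* (i) *)
      monotonically_bounded F ->
        order_bounded_operators E F = multi_bounded_operators E F /\
        equivalent_norms_on (order_bounded_operators E F)
          multi_bounded_norm b_norm,
      (* (ii) *)
      weak_nakano F ->
        equivalent_norms_on (order_bounded_operators E F)
          multi_bounded_norm b_norm /\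
        (nakano F -> forall T, order_bounded_operators E F T ->
           multi_bounded_norm T = b_norm T),
      (* (iii) *)
      monotonically_bounded F -> nakano F ->
        order_bounded_operators E F = multi_bounded_operators E F /\
        (forall T, order_bounded_operators E F T ->
           multi_bounded_norm T = b_norm T)
    & (* (iv) *)
      monotonically_bounded F -> dedekind_complete F ->
        [/\ regular_operators E F = order_bounded_operators E F,
            order_bounded_operators E F = multi_bounded_operators E F,
            equivalent_norms_on (regular_operators E F)
              multi_bounded_norm r_norm
          & nakano F -> forall T, regular_operators E F T ->
              multi_bounded_norm T = r_norm T]].
Proof.
have mb_equiv : monotonically_bounded F ->
    equivalent_norms_on (order_bounded_operators E F) multi_bounded_norm b_norm.
  by move=> /(@b_norm_le_monotonically_bounded R E F)[M M0]; exact: equivalent_mb_b_norm.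
split.
- by move=> mbF; split; [exact: order_bounded_eq_multi_bounded|exact: mb_equiv].
- move=> [K [K1 nakF]]; split; last by move=> nF T; exact: nakano_mb_norm_eq.
  have K0 : 0 < K by exact: lt_le_trans K1.
  by apply: (equivalent_mb_b_norm K0) => T; apply: b_norm_le_nakano; rewrite ?ltW.
- move=> mbF nF; split; first exact: order_bounded_eq_multi_bounded.
  by move=> T; exact: nakano_mb_norm_eq.
- move=> mbF dcF.
  have rob : regular_operators E F = order_bounded_operators E F.
    apply/seteqP; split=> T; first exact: regular_order_bounded.
    exact: order_bounded_regular.
  (* Since [r_norm] and [b_norm] agree on these operators, the constants for [b_norm] carry over. *)
  have [a [b [a0 b0 ab]]] := mb_equiv mbF.
  rewrite rob; split=> //; first exact: order_bounded_eq_multi_bounded.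
    by exists a, b; split=> // T Tob; rewrite r_norm_eq_b_norm //; exact: ab.
  by move=> nF T Tob; rewrite r_norm_eq_b_norm // nakano_mb_norm_eq.
Qed.
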